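(* Let $n \in \{2, 3\}$ and let $Q_n = [-1,1]^n \subset \mathbb{R}^n$. The critical central hyperplane sections of $Q_n$ are exactly the diagonal sections; that is, a unit vector $\mathbf{a} \in S^{n-1}$ is a critical direction if and only if it is a diagonal direction.
   Context: $S^{n-1}$ is the Euclidean unit sphere of $\mathbb{R}^n$, $\mathbf{a}^\perp = \{\mathbf{x} \in \mathbb{R}^n : \langle \mathbf{x}, \mathbf{a}\rangle = 0\}$, and $\mathrm{Vol}_{n-1}$ denotes $(n-1)$-dimensional volume (Hausdorff measure) in $\mathbb{R}^n$. A unit vector $\mathbf{a} \in S^{n-1}$ is a critical direction if it is a critical point of the function $V : S^{n-1} \to \mathbb{R}$, $V(\mathbf{a}) = \mathrm{Vol}_{n-1}(Q_n \cap \mathbf{a}^\perp)$, in the usual sense: either $V$ is differentiable at $\mathbf{a}$ (as a function on the sphere) and its differential vanishes there, or $V$ is not differentiable at $\mathbf{a}$. The critical central hyperplane sections are the sections $Q_n \cap \mathbf{a}^\perp$ with $\mathbf{a}$ a critical direction. For $1 \leq k \leq n$, a unit vector is a $k$-diagonal direction if, up to permuting the coordinates and changing signs, it is of the form $(\frac{1}{\sqrt k}, \ldots, \frac{1}{\sqrt k}, 0, \ldots, 0)$ with exactly $k$ non-zero coordinates; it is a diagonal direction if it is a $k$-diagonal direction for some $1 \leq k \leq n$. The diagonal sections are the sections $Q_n \cap \mathbf{a}^\perp$ with $\mathbf{a}$ a diagonal direction. *)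

(* Defs.v *)
From HB Require Import structures.
From mathcomp Require Import all_boot all_order all_algebra all_fingroup.
From mathcomp Require Import all_classical all_reals all_analysis.

Set Implicit Arguments.
Unset Strict Implicit.
Unset Printing Implicit Defensive.

Import Order.TTheory GRing.Theory Num.Theory.
Import numFieldNormedType.Exports.

Local Open Scope classical_set_scope.
Local Open Scope ring_scope.

Definition dot (R : realType) (n : nat) (x y : 'rV[R]_n) : R :=
  \sum_(i < n) x 0 i * y 0 i.

(* The library norm on 'rV[R]_n is the sup norm, hence this definition. The two
   norms induce the same topology, which is the one used below. *)
Definition enorm (R : realType) (n : nat) (x : 'rV[R]_n) : R :=
  Num.sqrt (dot x x).

Definition unit_sphere (R : realType) (n : nat) : set 'rV[R]_n :=
  [set x | enorm x = 1].
Arguments unit_sphere : clear implicits.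

Definition perp (R : realType) (n : nat) (a : 'rV[R]_n) : set 'rV[R]_n :=
  [set x | dot x a = 0].

Definition cube (R : realType) (n : nat) : set 'rV[R]_n :=
  [set x | forall i, -1 <= x 0 i <= 1].
Arguments cube : clear implicits.

(* Euclidean diameter; it is -oo on the empty set. *)
Definition diam (R : realType) (n : nat) (U : set 'rV[R]_n) : \bar R :=
  ereal_sup [set (enorm (x - y))%:E | x in U & y in U].

(* Lebesgue volume of the Euclidean unit ball of dimension m, by the recursion
   w_0 = 1, w_1 = 2, w_(m+2) = 2 pi / (m + 2) * w_m. *)
Fixpoint ball_volume (R : realType) (m : nat) : R :=
  match m with
  | 0 => 1
  | 1 => 2
  | m'.+2 => 2 * pi / m'.+2%:R * ball_volume R m'
  end.

(* w_m (diam U / 2)^m: with this factor the m-dimensional Hausdorff measure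
   agrees with Lebesgue measure on m-dimensional Euclidean subspaces. *)
Definition hausdorff_gauge (R : realType) (n m : nat) (U : set 'rV[R]_n) :
    \bar R :=
  if U == set0 then 0%E
  else ((ball_volume R m / 2 ^+ m)%:E * diam U ^+ m)%E.

Definition hausdorff_content (R : realType) (n m : nat) (delta : R)
    (A : set 'rV[R]_n) : \bar R :=
  ereal_inf [set (\sum_(0 <= i <oo) hausdorff_gauge m (U i))%E
    | U in [set U : (set 'rV[R]_n)^nat
           | A `<=` \bigcup_i U i /\ forall i, (diam (U i) <= delta%:E)%E]].

Definition hausdorff_measure (R : realType) (n m : nat) (A : set 'rV[R]_n) :
    \bar R :=
  ereal_sup [set hausdorff_content m delta A | delta in [set d : R | 0 < d]].

(* Only the values on the unit sphere matter; they are finite, so that [fine]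
   loses nothing there. *)
Definition section_volume (R : realType) (n : nat) (a : 'rV[R]_n) : R :=
  fine (hausdorff_measure n.-1 (cube R n `&` perp a)).

(* First-order expansion at a of a function on the sphere,
     f x = f a + L (x - a) + o(|x - a|)  as x -> a, x on the sphere.
   Only the restriction of the linear form L to the tangent space [perp a] is
   determined by f; that restriction is the differential of f at a. *)
Definition has_sphere_differential (R : realType) (n : nat)
    (f : 'rV[R]_n -> R) (a : 'rV[R]_n) (L : {scalar 'rV[R]_n}) : Prop :=
  (f x - f a - L (x - a)) / enorm (x - a)
    @[x --> within (unit_sphere R n) a^'] --> (0 : R).

Definition sphere_differentiable (R : realType) (n : nat)
    (f : 'rV[R]_n -> R) (a : 'rV[R]_n) : Prop :=
  exists L : {scalar 'rV[R]_n}, has_sphere_differential f a L.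

Definition sphere_critical_point (R : realType) (n : nat)
    (f : 'rV[R]_n -> R) (a : 'rV[R]_n) : Prop :=
  (exists2 L : {scalar 'rV[R]_n}, has_sphere_differential f a L
      & forall v, perp a v -> L v = 0)
  \/ ~ sphere_differentiable f a.

Definition critical_direction (R : realType) (n : nat) (a : 'rV[R]_n) : Prop :=
  unit_sphere R n a /\ sphere_critical_point (@section_volume R n) a.

Definition diagonal_vector (R : realType) (n k : nat) : 'rV[R]_n :=
  \row_(i < n) (if (i < k)%N then (Num.sqrt k%:R)^-1 else 0).

Definition k_diagonal_direction (R : realType) (n k : nat) (a : 'rV[R]_n) :
    Prop :=
  exists (s : 'S_n) (e : 'I_n -> bool),
    a = \row_(i < n) ((-1) ^+ e i * diagonal_vector R n k 0 (s i)).

Definition diagonal_direction (R : realType) (n : nat) (a : 'rV[R]_n) : Prop :=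
  exists2 k : nat, (1 <= k <= n)%N & k_diagonal_direction k a.

(* Main.v *)
(* The Hausdorff measure of a section is needed only up to a constant factor: a
   rescaling of the section volume by a finite positive constant does not change
   its critical points. Additivity along straight cuts, invariance under
   isometries and homogeneity under dilations already give that the Hausdorff
   area of a parallelogram is [sqrt (gram u v)] times the area of a unit square,
   and comparison with Lebesgue measure shows that this last area is positive.

   For nonnegative a_0 >= a_1 >= a_2, the section is a parallelogram over
   [-1, 1]^2 when a_1 + a_2 <= a_0, with volume proportional to 1 / a_0, and that
   parallelogram without two congruent triangles otherwise, with volume
   proportional to
     (4 a_1 a_2 - (a_1 + a_2 - a_0)^2) / (a_0 a_1 a_2)
       = 2 (1 / a_0 + 1 / a_1 + 1 / a_2) - 1 / (a_0 a_1 a_2)   on the sphere.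
   The first regime is critical only at (1, 0, 0), the second only at the main
   diagonal; the two expressions agree to first order along the common boundary,
   except at the 2-diagonal direction, where the volume has a kink. *)
Require Import Defs.
From HB Require Import structures.
From mathcomp Require Import all_boot all_order all_algebra all_fingroup.
From mathcomp Require Import all_classical all_reals all_analysis.
From mathcomp Require Import ring lra.

Set Implicit Arguments.
Unset Strict Implicit.
Unset Printing Implicit Defensive.

Import Order.TTheory GRing.Theory Num.Theory.
Import numFieldNormedType.Exports.

Local Open Scope classical_set_scope.
Local Open Scope ring_scope.

(** * Hausdorff measure *)

(** The Hausdorff measure is here a bare supremum of infima over covers. What comes cheaply is
    subadditivity, Lipschitz comparison of images, and additivity for sets at a positive distance.
    The two pieces of a straight cut touch, so the cut is thickened to a layer of small area; the
    area of a thin strip is bounded beforehand by stacking small squares, which takes only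
    homogeneity, subadditivity and a unit square of finite area. That finiteness comes from
    self-similarity. Keeping the area of the unit square as an unknown constant avoids the
    isodiametric inequality, on which the exact normalisation rests. A critical point is defined by
    the existence or the failure of a linear form, so both alternatives have to be decided:
    expansions with quadratic remainder give an explicit differential, unique on tangent vectors,
    while a curve through the point exhibits a kink. The volume formulas do not assume sorted
    coordinates, because the neighbours of a sorted direction are in general not sorted. *)

Lemma dot_ge0 (R : realType) n (x : 'rV[R]_n) : 0 <= dot x x.
Proof. by apply: sumr_ge0 => i _; rewrite -expr2 sqr_ge0. Qed.

Lemma enorm_ge0 (R : realType) n (x : 'rV[R]_n) : 0 <= enorm x.
Proof. exact: sqrtr_ge0. Qed.

Lemma sqr_enorm (R : realType) n (x : 'rV[R]_n) : enorm x ^+ 2 = dot x x.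
Proof. by rewrite sqr_sqrtr // dot_ge0. Qed.

Lemma normr_le_enorm (R : realType) n (x : 'rV[R]_n) i : `|x 0 i| <= enorm x.
Proof.
rewrite -(sqrtr_sqr (x 0 i)) ler_sqrt ?dot_ge0 // /dot (bigD1 i) //= -expr2.
by rewrite lerDl sumr_ge0 // => j _; rewrite -expr2 sqr_ge0.
Qed.

Lemma enorm0 (R : realType) n : enorm (0 : 'rV[R]_n) = 0.
Proof. by rewrite /enorm /dot big1 ?sqrtr0 // => i _; rewrite mxE mul0r. Qed.

Lemma expe_le (R : realType) m (x y : \bar R) :
  (0 <= x -> x <= y -> x ^+ m <= y ^+ m)%E.
Proof.
move=> x0 xy; elim: m => [//|m IH].
by rewrite !expeS lee_pmul // expe_ge0.
Qed.

Lemma expeMl (R : realType) m (t : R) (x : \bar R) :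
  ((t%:E * x) ^+ m = (t ^+ m)%:E * x ^+ m)%E.
Proof.
elim: m => [|m IH]; first by rewrite !expe0 expr0 mul1e.
by rewrite !expeS IH exprS EFinM muleACA.
Qed.

Section HausdorffContent.
Context {R : realType}.
Implicit Types (n m : nat) (delta t : R).

Lemma ball_volume_gt0 m : 0 < ball_volume R m.
Proof.
have [k] := ubnP m; elim: k m => // k IH [|[|m]] //= mk.
rewrite mulr_gt0 ?divr_gt0 ?mulr_gt0 ?pi_gt0 ?ltr0n // IH //.
exact: ltnW mk.
Qed.

Definition gauge_factor m : R := ball_volume R m / 2 ^+ m.

Lemma gauge_factor_gt0 m : 0 < gauge_factor m.
Proof. by rewrite divr_gt0 ?ball_volume_gt0 ?exprn_gt0. Qed.

Lemma diam_ge0 n (U : set 'rV[R]_n) : U !=set0 -> (0 <= diam U)%E.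
Proof.
move=> [x Ux]; apply: ereal_sup_ubound => /=.
by exists x => //; exists x => //; rewrite subrr enorm0.
Qed.

Lemma diam_ub n (U : set 'rV[R]_n) x y :
  U x -> U y -> ((enorm (x - y))%:E <= diam U)%E.
Proof. by move=> Ux Uy; apply: ereal_sup_ubound => /=; exists x => //; exists y. Qed.

Lemma hausdorff_gauge_set0 n m : hausdorff_gauge m (set0 : set 'rV[R]_n) = 0%E.
Proof. by rewrite /hausdorff_gauge eqxx. Qed.

Lemma hausdorff_gaugeE n m (U : set 'rV[R]_n) : U !=set0 ->
  hausdorff_gauge m U = ((gauge_factor m)%:E * diam U ^+ m)%E.
Proof. by move=> /set0P /negbTE U0; rewrite /hausdorff_gauge U0. Qed.

Lemma hausdorff_gauge_ge0 n m (U : set 'rV[R]_n) : (0 <= hausdorff_gauge m U)%E.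
Proof.
have [->|/set0P U0] := eqVneq U set0; first by rewrite hausdorff_gauge_set0.
rewrite hausdorff_gaugeE // mule_ge0 ?expe_ge0 ?diam_ge0 //.
by rewrite lee_fin ltW // gauge_factor_gt0.
Qed.

Lemma hausdorff_content_le n m delta (A : set 'rV[R]_n) (U : (set 'rV[R]_n)^nat) :
  A `<=` \bigcup_i U i -> (forall i, (diam (U i) <= delta%:E)%E) ->
  (hausdorff_content m delta A <= \sum_(0 <= i <oo) hausdorff_gauge m (U i))%E.
Proof. by move=> AU Ud; apply: ereal_inf_lbound; exists U. Qed.

Lemma le_hausdorff_content n m delta (A : set 'rV[R]_n) (z : \bar R) :
  (forall U : (set 'rV[R]_n)^nat,
    A `<=` \bigcup_i U i -> (forall i, (diam (U i) <= delta%:E)%E) ->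
    (z <= \sum_(0 <= i <oo) hausdorff_gauge m (U i))%E) ->
  (z <= hausdorff_content m delta A)%E.
Proof. by move=> H; apply: le_ereal_inf_tmp => _ [U [AU Ud] <-]; exact: H. Qed.

Lemma hausdorff_content_ge0 n m delta (A : set 'rV[R]_n) :
  (0 <= hausdorff_content m delta A)%E.
Proof.
apply: le_hausdorff_content => U _ _.
by apply: nneseries_ge0 => i _ _; exact: hausdorff_gauge_ge0.
Qed.

Lemma hausdorff_content_anti n m delta delta' (A : set 'rV[R]_n) :
  delta <= delta' ->
  (hausdorff_content m delta' A <= hausdorff_content m delta A)%E.
Proof.
move=> dd; apply: le_hausdorff_content => U AU Ud.
by apply: hausdorff_content_le => // i; rewrite (le_trans (Ud i)) ?lee_fin.
Qed.

Lemma diam_set0 n : diam (set0 : set 'rV[R]_n) = -oo%E.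
Proof.
rewrite /diam (_ : [set _ | _ in _ & _ in _] = set0) ?ereal_sup0 //.
by apply/seteqP; split => // z [x []].
Qed.

Lemma diam_image (T : Type) n n' (D : set T) (phi : T -> 'rV[R]_n)
    (psi : T -> 'rV[R]_n') t (U : set 'rV[R]_n) : 0 < t ->
  (forall p q, D p -> D q ->
     enorm (psi p - psi q) <= t * enorm (phi p - phi q)) ->
  (diam (psi @` (D `&` phi @^-1` U)) <= t%:E * diam U)%E.
Proof.
move=> t0 lip; apply: ge_ereal_sup => _ [_ [p [Dp Up] <-]] [_ [q [Dq Uq] <-]] <-.
apply: (@le_trans _ _ (t%:E * (enorm (phi p - phi q))%:E)%E).
  by rewrite -EFinM lee_fin lip.
by rewrite lee_pmul2l // ?lte_fin //; apply: diam_ub.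
Qed.

(** Comparing two images of one parameter set avoids inverse maps: a cover of the image of [phi] is
    pulled back to [D] and pushed forward by [psi]. *)
Lemma hausdorff_content_image (T : Type) n n' m delta (D : set T)
    (phi : T -> 'rV[R]_n) (psi : T -> 'rV[R]_n') t : 0 < t ->
  (forall p q, D p -> D q ->
     enorm (psi p - psi q) <= t * enorm (phi p - phi q)) ->
  (hausdorff_content m (t * delta) (psi @` D) <=
   (t ^+ m)%:E * hausdorff_content m delta (phi @` D))%E.
Proof.
move=> t0 lip; rewrite -lee_pdivrMl ?exprn_gt0 //.
apply: le_hausdorff_content => U AU Ud; rewrite lee_pdivrMl ?exprn_gt0 //.
pose V i := psi @` (D `&` phi @^-1` (U i)).
rewrite -nneseriesZl; last by move=> i _; exact: hausdorff_gauge_ge0.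
have dV i : (diam (V i) <= t%:E * diam (U i))%E by exact: diam_image.
apply: (@le_trans _ _ (\sum_(0 <= i <oo) hausdorff_gauge m (V i))%E).
  apply: hausdorff_content_le.
    move=> _ [p Dp <-]; have [|i _ Ui] := AU (phi p); first by exists p.
    by exists i => //; exists p.
  by move=> i; rewrite (le_trans (dV i)) // EFinM lee_pmul2l // lte_fin.
apply: lee_nneseries => [i _ _|i _]; first exact: hausdorff_gauge_ge0.
(* The empty set has diameter [-oo], so powers of diameters are compared only when [V i] is
   nonempty. *)
have [->|/set0P ne] := eqVneq (V i) set0.
  by rewrite hausdorff_gauge_set0 mule_ge0 ?hausdorff_gauge_ge0 // lee_fin exprn_ge0 // ltW.
have neU : U i !=set0 by case: ne => _ [p [Dp Up] _]; exists (phi p).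
rewrite !hausdorff_gaugeE // muleCA -expeMl lee_pmul2l ?lte_fin ?gauge_factor_gt0 //.
by apply: expe_le; [exact: diam_ge0|exact: dV].
Qed.

Lemma nneseries_le_ub (u : (\bar R)^nat) z : (forall i, (0 <= u i)%E) ->
  (forall k, (\sum_(0 <= i < k) u i <= z)%E) -> (\sum_(0 <= i <oo) u i <= z)%E.
Proof.
move=> u0 uz; apply: lime_le; last exact: nearW.
by apply: is_cvg_nneseries => i _ _.
Qed.

Lemma hausdorff_contentU n m delta (A B : set 'rV[R]_n) :
  (hausdorff_content m delta (A `|` B) <=
   hausdorff_content m delta A + hausdorff_content m delta B)%E.
Proof.
have [->|Afin] := eqVneq (hausdorff_content m delta A) +oo%E.
  by rewrite addye ?leey // gt_eqF // (lt_le_trans _ (hausdorff_content_ge0 _ _ _)).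
have Af : hausdorff_content m delta A \is a fin_num.
  by rewrite ge0_fin_numE ?hausdorff_content_ge0 // lt_neqAle Afin leey.
rewrite addeC -leeBlDr //; apply: le_hausdorff_content => V BV Vd.
rewrite leeBlDr // addeC.
have [->|Vfin] := eqVneq (\sum_(0 <= i <oo) hausdorff_gauge m (V i))%E +oo%E.
  by rewrite addey ?leey // gt_eqF // (lt_le_trans _ (hausdorff_content_ge0 _ _ _)).
have Vf : (\sum_(0 <= i <oo) hausdorff_gauge m (V i))%E \is a fin_num.
  rewrite ge0_fin_numE ?lt_neqAle ?Vfin ?leey //.
  by apply: nneseries_ge0 => i _ _; exact: hausdorff_gauge_ge0.
rewrite -leeBlDr //; apply: le_hausdorff_content => U AU Ud; rewrite leeBlDr //.
(* The two covers are interleaved. A partial sum of length [k] is at most the one of length [k.*2],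
   which consists of the first [k] terms of each cover. *)
pose W i := if odd i then V i./2 else U i./2.
have W0 i : (0 <= hausdorff_gauge m (W i))%E by exact: hausdorff_gauge_ge0.
apply: (@le_trans _ _ (\sum_(0 <= i <oo) hausdorff_gauge m (W i))%E).
  apply: hausdorff_content_le.
    move=> x [Ax|Bx].
      have [i _ Ui] := AU x Ax; exists i.*2 => //.
      by rewrite /W odd_double doubleK.
    have [i _ Vi] := BV x Bx; exists i.*2.+1 => //.
    by rewrite /W /= odd_double /= uphalf_double.
  by move=> i; rewrite /W; case: ifP.
apply: nneseries_le_ub => // k.
apply: (@le_trans _ _ (\sum_(0 <= i < k.*2) hausdorff_gauge m (W i))%E).
  rewrite (@big_cat_nat _ _ _ k _ k.*2) //=; last by rewrite -addnn leq_addr.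
  by rewrite leeDl // sume_ge0.
have -> : (\sum_(0 <= i < k.*2) hausdorff_gauge m (W i) =
   \sum_(0 <= i < k) hausdorff_gauge m (U i) +
   \sum_(0 <= i < k) hausdorff_gauge m (V i))%E.
  elim: k => [|k IH]; first by rewrite !big_geq // adde0.
  have We : W k.*2 = U k by rewrite /W odd_double doubleK.
  have Wo : W k.*2.+1 = V k by rewrite /W /= odd_double /= uphalf_double.
  rewrite doubleS !big_nat_recr //= IH We Wo -!addeA.
  by congr (_ + _)%E; rewrite addeCA.
by apply: leeD; apply: nneseries_lim_ge => i _ _; exact: hausdorff_gauge_ge0.
Qed.

(** A set of diameter at most [delta] cannot meet both [A] and [B], so every admissible cover of the
    union splits into a cover of [A] and a cover of [B] that share no nonempty member. *)
Lemma le_hausdorff_contentD n m delta eta (A B : set 'rV[R]_n) : delta < eta ->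
  (forall x y, A x -> B y -> eta <= enorm (x - y)) ->
  (hausdorff_content m delta A + hausdorff_content m delta B <=
   hausdorff_content m delta (A `|` B))%E.
Proof.
move=> de sep; apply: le_hausdorff_content => W ABW Wd.
pose part (C : set 'rV[R]_n) i := if pselect (W i `&` C !=set0) then W i else set0.
have cpart (C : set 'rV[R]_n) : C `<=` A `|` B ->
   (hausdorff_content m delta C <= \sum_(0 <= i <oo) hausdorff_gauge m (part C i))%E.
  move=> CAB; apply: hausdorff_content_le => [x Cx|i].
    have [i _ Wi] := ABW x (CAB x Cx); exists i => //.
    by rewrite /part; case: pselect => //= WC; exfalso; apply: WC; exists x.
  by rewrite /part; case: pselect => //= _; rewrite diam_set0 leNye.
have cA := cpart A (@subsetUl _ A B); have cB := cpart B (@subsetUr _ A B).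
apply: (le_trans (leeD cA cB)).
rewrite -nneseriesD; [|by move=> *; exact: hausdorff_gauge_ge0..].
apply: lee_nneseries => [i _ _|i _].
  by rewrite adde_ge0 // hausdorff_gauge_ge0.
rewrite /part; case: pselect => /= [[x [Wx Ax]]|_]; last first.
  by rewrite hausdorff_gauge_set0 add0e; case: pselect => //= _;
     rewrite hausdorff_gauge_set0 hausdorff_gauge_ge0.
case: pselect => /= [[y [Wy By]]|_]; last by rewrite hausdorff_gauge_set0 adde0.
have := le_trans (diam_ub Wx Wy) (Wd i); rewrite lee_fin.
by move=> /(le_trans (sep x y Ax By)); rewrite leNgt de.
Qed.


Lemma hausdorff_content_le_measure n m delta (A : set 'rV[R]_n) : 0 < delta ->
  (hausdorff_content m delta A <= hausdorff_measure m A)%E.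
Proof. by move=> d0; apply: ereal_sup_ubound; exists delta. Qed.

Lemma hausdorff_measure_le n m (A : set 'rV[R]_n) z :
  (forall delta, 0 < delta -> (hausdorff_content m delta A <= z)%E) ->
  (hausdorff_measure m A <= z)%E.
Proof. by move=> H; apply: ge_ereal_sup => _ [d d0 <-]; exact: H. Qed.

Lemma hausdorff_measure_ge0 n m (A : set 'rV[R]_n) : (0 <= hausdorff_measure m A)%E.
Proof.
exact: le_trans (hausdorff_content_ge0 m 1 A) (hausdorff_content_le_measure _ _ _).
Qed.

Lemma hausdorff_measure_image (T : Type) n n' m (D : set T)
    (phi : T -> 'rV[R]_n) (psi : T -> 'rV[R]_n') t : 0 < t ->
  (forall p q, D p -> D q ->
     enorm (psi p - psi q) <= t * enorm (phi p - phi q)) ->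
  (hausdorff_measure m (psi @` D) <=
   (t ^+ m)%:E * hausdorff_measure m (phi @` D))%E.
Proof.
move=> t0 lip; apply: hausdorff_measure_le => d d0.
have dE : d = t * (d / t) by rewrite mulrC divfK ?gt_eqF.
rewrite {1}dE; apply: le_trans (hausdorff_content_image _ _ t0 lip) _.
rewrite lee_pmul2l ?lte_fin ?exprn_gt0 //.
by apply: hausdorff_content_le_measure; rewrite divr_gt0.
Qed.

Lemma le_hausdorff_content_set n m delta (A B : set 'rV[R]_n) : A `<=` B ->
  (hausdorff_content m delta A <= hausdorff_content m delta B)%E.
Proof.
move=> AB; apply: le_hausdorff_content => U BU Ud.
by apply: hausdorff_content_le => // x /AB /BU.
Qed.

Lemma le_hausdorff_measure n m (A B : set 'rV[R]_n) : A `<=` B ->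
  (hausdorff_measure m A <= hausdorff_measure m B)%E.
Proof.
move=> AB; apply: hausdorff_measure_le => d d0.
exact: le_trans (le_hausdorff_content_set _ _ AB) (hausdorff_content_le_measure _ _ d0).
Qed.

Lemma hausdorff_measureU n m (A B : set 'rV[R]_n) :
  (hausdorff_measure m (A `|` B) <= hausdorff_measure m A + hausdorff_measure m B)%E.
Proof.
apply: hausdorff_measure_le => d d0.
by apply: le_trans (hausdorff_contentU _ _ _ _) (leeD _ _);
  exact: hausdorff_content_le_measure.
Qed.

(** The metric outer measure property. The case of an infinite right-hand side is settled first, so
    that the two suprema on the left can be treated one at a time by subtraction. *)
Lemma le_hausdorff_measureD n m eta (A B : set 'rV[R]_n) : 0 < eta ->
  (forall x y, A x -> B y -> eta <= enorm (x - y)) ->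
  (hausdorff_measure m A + hausdorff_measure m B <= hausdorff_measure m (A `|` B))%E.
Proof.
move=> e0 sep.
have [->|ABfin] := eqVneq (hausdorff_measure m (A `|` B)) +oo%E; first exact: leey.
have ABf : hausdorff_measure m (A `|` B) \is a fin_num.
  by rewrite ge0_fin_numE ?hausdorff_measure_ge0 // lt_neqAle ABfin leey.
have Bf : hausdorff_measure m B \is a fin_num.
  rewrite ge0_fin_numE ?hausdorff_measure_ge0 //.
  apply: le_lt_trans (le_hausdorff_measure _ (@subsetUr _ A B)) _.
  by rewrite -ge0_fin_numE ?hausdorff_measure_ge0.
have cf d : 0 < d -> hausdorff_content m d A \is a fin_num.
  move=> d0; rewrite ge0_fin_numE ?hausdorff_content_ge0 //.
  apply: le_lt_trans (hausdorff_content_le_measure _ _ d0) _.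
  apply: le_lt_trans (le_hausdorff_measure _ (@subsetUl _ A B)) _.
  by rewrite -ge0_fin_numE ?hausdorff_measure_ge0.
rewrite -leeBrDr //; apply: hausdorff_measure_le => d d0.
rewrite leeBrDr // addeC -leeBrDr ?cf //; apply: hausdorff_measure_le => d' d'0.
rewrite leeBrDr ?cf //.
(* A common scale: contents grow as the scale shrinks, and below [eta] they add up. *)
pose e := Num.min (Num.min d d') (eta / 2).
have ed : e <= d by rewrite /e !ge_min lexx.
have ed' : e <= d' by rewrite /e !ge_min lexx orbT.
have ee : e < eta.
  rewrite /e gt_min; apply/orP; right; lra.
have e00 : 0 < e by rewrite /e !lt_min d0 d'0 divr_gt0.
rewrite addeC; apply: le_trans (hausdorff_content_le_measure _ _ e00).
apply: le_trans (le_hausdorff_contentD _ ee sep).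
by apply: leeD; exact: hausdorff_content_anti.
Qed.

(* The last hypothesis holds when [A] is covered by 2^m copies of itself scaled by
   1/2, since scaling by 1/2 divides each gauge by 2^m. *)
Lemma self_similar_hausdorff_finite n m (A : set 'rV[R]_n) : A !=set0 ->
  (diam A < +oo)%E ->
  (forall delta, (hausdorff_content m (delta / 2) A <= hausdorff_content m delta A)%E) ->
  (hausdorff_measure m A < +oo)%E.
Proof.
move=> A0 Afin half.
have dA : diam A \is a fin_num by rewrite ge0_fin_numE ?diam_ge0.
pose d := fine (diam A).
have d0 : 0 <= d by rewrite fine_ge0 // diam_ge0.
have base : (hausdorff_content m d A <= hausdorff_gauge m A)%E.
  pose U (i : nat) : set 'rV[R]_n := if i is 0%N then A else set0.
  have AU : A `<=` \bigcup_i U i by move=> x Ax; exists 0%N.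
  have Ud i : (diam (U i) <= d%:E)%E.
    by case: i => [|i]; rewrite /= ?diam_set0 ?leNye // /d fineK.
  apply: le_trans (hausdorff_content_le _ AU Ud) _.
  apply: nneseries_le_ub => [i|k]; first exact: hausdorff_gauge_ge0.
  case: k => [|k]; first by rewrite big_geq // hausdorff_gauge_ge0.
  rewrite big_nat_recl // big1 ?adde0 // => i _.
  by rewrite /= hausdorff_gauge_set0.
have iter k : (hausdorff_content m (d / 2 ^+ k) A <= hausdorff_gauge m A)%E.
  elim: k => [|k IH]; first by rewrite expr0 divr1.
  rewrite exprSr invfM mulrA; exact: le_trans (half _) IH.
apply: (@le_lt_trans _ _ (hausdorff_gauge m A)); last first.
  rewrite hausdorff_gaugeE // -(fineK dA) -EFin_expe -EFinM ltry //.
apply: hausdorff_measure_le => e e0.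
have [k dk] : exists k : nat, d / 2 ^+ k <= e.
  exists (Num.truncn (d / e)).+1.
  rewrite ler_pdivrMr ?exprn_gt0 // mulrC -ler_pdivrMr //.
  apply: le_trans (ltW (truncnS_gt _)) _.
  by rewrite -natrX ler_nat ltnW // ltn_expl.
exact: le_trans (hausdorff_content_anti _ _ dk) (iter k).
Qed.

End HausdorffContent.

(** * Comparison with Lebesgue measure *)

(** The mass distribution principle: if preimages of sets of diameter [r] have mass at most
    [K * r ^+ m], the masses of the members of a cover bound the mass of [Q]. A preimage of an
    arbitrary set may fail to be measurable, hence the enclosing set [B]. *)
Lemma mass_distribution (R : realType) d (T : measurableType d)
    (mu : {measure set T -> \bar R}) n m (phi : T -> 'rV[R]_n) (Q : set T) (K : R) :
  0 < K -> measurable Q ->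
  (forall (U : set 'rV[R]_n) r, 0 <= r -> U !=set0 -> (diam U <= r%:E)%E ->
    exists B, [/\ measurable B, phi @^-1` U `<=` B & (mu B <= (K * r ^+ m)%:E)%E]) ->
  (mu Q <= (K / gauge_factor m)%:E * hausdorff_measure m (phi @` Q))%E.
Proof.
move=> K0 mQ box; have g0 := @gauge_factor_gt0 R m.
have c0 : 0 < K / gauge_factor m by rewrite divr_gt0.
apply: (@le_trans _ _ ((K / gauge_factor m)%:E * hausdorff_content m 1 (phi @` Q))%E);
  last first.
  by rewrite lee_pmul2l ?lte_fin //; exact: hausdorff_content_le_measure.
rewrite -lee_pdivrMl //; apply: le_hausdorff_content => U QU Ud.
rewrite lee_pdivrMl // -nneseriesZl; last first.
  by move=> i _; exact: hausdorff_gauge_ge0.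
have /choice [B HB] : forall i, exists B, [/\ measurable B, phi @^-1` (U i) `<=` B
    & (mu B <= (K / gauge_factor m)%:E * hausdorff_gauge m (U i))%E].
  move=> i; have [->|/set0P ne] := eqVneq (U i) set0.
    by exists set0; split => //; rewrite measure0 hausdorff_gauge_set0 mule0.
  have fin : diam (U i) \is a fin_num.
    by rewrite ge0_fin_numE ?diam_ge0 // (le_lt_trans (Ud i)) ?ltry.
  have [|||C [mC UC muC]] := box (U i) (fine (diam (U i))) => //.
  - by rewrite fine_ge0 // diam_ge0.
  - by rewrite fineK.
  exists C; split => //; rewrite hausdorff_gaugeE // -(fineK fin) -EFin_expe.
  by rewrite -!EFinM mulrA divfK ?gt_eqF.
apply: (@le_trans _ _ (\sum_(0 <= i <oo) mu (B i))%E).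
  apply: measure_sigma_subadditive => // [i|p Qp]; first by case: (HB i).
  have [|i _ Ui] := QU (phi p); first by exists p.
  by exists i => //; case: (HB i) => _ + _; apply.
by apply: lee_nneseries => i _ //; case: (HB i).
Qed.

Definition frame_point (R : realType) n (u v : 'rV[R]_n) (z : R * R) : 'rV[R]_n :=
  z.1 *: u + z.2 *: v.

Definition rect (R : realType) (x p y q : R) : set (R * R) :=
  [set z | x <= z.1 <= p /\ y <= z.2 <= q].

(** Plane regions are given by their coordinates in a possibly oblique frame, so that cuts and
    affine changes of variables act on subsets of [R * R], whatever the ambient dimension. *)
Definition frame_area (R : realType) n (u v : 'rV[R]_n) (D : set (R * R)) : \bar R :=
  hausdorff_measure 2 (frame_point u v @` D).

Definition orthonormal_frame (R : realType) n (u v : 'rV[R]_n) :=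
  [/\ dot u u = 1, dot v v = 1 & dot u v = 0].

Section Dot.
Context {R : realType} {n : nat}.
Implicit Types (x y z : 'rV[R]_n) (k : R).

Lemma dotC x y : dot x y = dot y x.
Proof. by apply: eq_bigr => i _; rewrite mulrC. Qed.

Lemma dotDl x y z : dot (x + y) z = dot x z + dot y z.
Proof. by rewrite /dot -big_split; apply: eq_bigr => i _; rewrite mxE mulrDl. Qed.

Lemma dotZl k x y : dot (k *: x) y = k * dot x y.
Proof. by rewrite /dot mulr_sumr; apply: eq_bigr => i _; rewrite mxE mulrA. Qed.

Lemma dotDr x y z : dot x (y + z) = dot x y + dot x z.
Proof. by rewrite dotC dotDl !(dotC x). Qed.

Lemma dotZr k x y : dot x (k *: y) = k * dot x y.
Proof. by rewrite dotC dotZl dotC. Qed.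

Lemma enormZ k x : enorm (k *: x) = `|k| * enorm x.
Proof. by rewrite /enorm dotZl dotZr mulrA -expr2 sqrtrM ?sqr_ge0 // sqrtr_sqr. Qed.

Lemma enormN x : enorm (- x) = enorm x.
Proof. by rewrite -scaleN1r enormZ normrN1 mul1r. Qed.

Lemma enormBC x y : enorm (x - y) = enorm (y - x).
Proof. by rewrite -enormN opprB. Qed.

End Dot.

Section FrameArea.
Context {R : realType} {n : nat}.
Implicit Types (u v : 'rV[R]_n) (D : set (R * R)) (z : R * R) (k x y : R).

Lemma frame_pointB u v z z' :
  frame_point u v z - frame_point u v z' = frame_point u v (z.1 - z'.1, z.2 - z'.2).
Proof. by rewrite /frame_point /= !scalerBl opprD addrACA. Qed.

Lemma frame_pointZ u v k x y :
  frame_point u v (k * x, k * y) = k *: frame_point u v (x, y).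
Proof. by rewrite /frame_point /= scalerDr !scalerA. Qed.

Lemma sqr_enorm_frame_point u v z : enorm (frame_point u v z) ^+ 2 =
  z.1 ^+ 2 * dot u u + 2 * z.1 * z.2 * dot u v + z.2 ^+ 2 * dot v v.
Proof.
rewrite sqr_enorm /frame_point !(dotDl, dotDr, dotZl, dotZr) (dotC v u); ring.
Qed.

Lemma enorm_orthonormal u v z : orthonormal_frame u v ->
  enorm (frame_point u v z) = Num.sqrt (z.1 ^+ 2 + z.2 ^+ 2).
Proof.
case=> uu vv uv; rewrite -[LHS]ger0_norm ?enorm_ge0 // -sqrtr_sqr.
by rewrite sqr_enorm_frame_point uu vv uv mulr0 addr0 !mulr1.
Qed.

Lemma lebesgue_measure_ball_itv (c r : R) : 0 <= r ->
  lebesgue_measure (`[c - r, c + r] : set R) = (2 * r)%:E.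
Proof.
move=> r0; rewrite lebesgue_measure_itv /= lte_fin. case: ifPn => cr.
  by rewrite -EFinD; congr EFin; ring.
have -> : r = 0 by lra.
by rewrite mulr0.
Qed.

Lemma lebesgue_measure_unit_itv : lebesgue_measure (`[0%R, 1%R] : set R) = 1%E.
Proof. by rewrite lebesgue_measure_itv /= lte_fin ltr01 oppr0 adde0. Qed.

Lemma hausdorff_line_gt0 u : enorm u = 1 ->
  (0 < hausdorff_measure 1 ((fun s => s *: u) @` `[0%R, 1%R]))%E.
Proof.
move=> u1; have K0 : 0 < 2 / @gauge_factor R 1 by rewrite divr_gt0 ?gauge_factor_gt0.
have := @mass_distribution R _ _ (@lebesgue_measure R) n 1 (fun s : R => s *: u)
  `[0%R, 1%R] 2 (ltr0Sn _ _).
move=> H.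
rewrite -(@pmule_rgt0 _ (2 / @gauge_factor R 1)%:E) ?lte_fin //.
apply: lt_le_trans (H _ _).
- by rewrite [ltRHS]lebesgue_measure_unit_itv.
- exact: measurable_itv.
move=> U r r0 [x Ux] Ur.
have [[s Us]|no] := pselect (exists s : R, U (s *: u)); last first.
  exists set0; split => //; first by move=> s Us; apply: no; exists s.
  by rewrite measure0 lee_fin mulr_ge0 ?exprn_ge0.
(* On a unit vector the parameter is an arc length, so all parameters of points of [U] lie within
   [r] of [s]; the length [2 * r] explains the constant 2. *)
exists [set` `[s - r, s + r]]; split; first exact: measurable_itv; last first.
  by rewrite [leLHS]lebesgue_measure_ball_itv // expr1.
move=> t /= Ut; have := le_trans (diam_ub Ut Us) Ur.
by rewrite lee_fin -scalerBl enormZ u1 mulr1 in_itv /= ler_distl.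
Qed.

Lemma frame_area_unit_gt0 u v : orthonormal_frame u v ->
  (0 < frame_area u v (rect 0 1 0 1))%E.
Proof.
move=> ouv; have K0 : 0 < 4 / @gauge_factor R 2 by rewrite divr_gt0 ?gauge_factor_gt0.
have QE : rect 0 1 0 1 = (`[0%R, 1%R] `*` `[0%R, 1%R] : set (R * R)).
  by apply/seteqP; split => -[s t] /=; rewrite /rect !in_itv.
have := @mass_distribution R _ _ (@lebesgue_measure R \x @lebesgue_measure R)%E n 2
  (frame_point u v) (rect 0 1 0 1) 4 (ltr0Sn _ _).
move=> H.
rewrite -(@pmule_rgt0 _ (4 / @gauge_factor R 2)%:E) ?lte_fin //.
have mI (i : interval R) : measurable ([set` i] : set R) by exact: measurable_itv.
apply: lt_le_trans (H _ _).
- rewrite QE [ltRHS]product_measure1E //.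
  by rewrite [X in (_ < X * _)%E]lebesgue_measure_unit_itv
    [X in (_ < _ * X)%E]lebesgue_measure_unit_itv mule1.
- by rewrite QE; exact: measurableX.
move=> U r r0 [x Ux] Ur.
have [[z Uz]|no] := pselect (exists z, U (frame_point u v z)); last first.
  exists set0; split => //; first by move=> s Us; apply: no; exists s.
  by rewrite measure0 lee_fin mulr_ge0 ?exprn_ge0.
(* In an orthonormal frame each coordinate moves by at most the distance; the square of side [2 * r]
   explains the constant 4. *)
exists ([set` `[z.1 - r, z.1 + r]] `*` [set` `[z.2 - r, z.2 + r]]); split.
- by apply: measurableX.
- move=> t /= Ut; have := le_trans (diam_ub Ut Uz) Ur.
  rewrite lee_fin frame_pointB enorm_orthonormal //= => le_r.
  have le1 (a b : R) : `|a| <= Num.sqrt (a ^+ 2 + b ^+ 2).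
    by rewrite -(sqrtr_sqr a) ler_sqrt ?addr_ge0 ?sqr_ge0 // lerDl sqr_ge0.
  rewrite !in_itv /= -!ler_distl; split; apply: le_trans le_r; first exact: le1.
  by rewrite [in leRHS]addrC le1.
- rewrite [leLHS]product_measure1E //.
  rewrite [X in (X * _ <= _)%E]lebesgue_measure_ball_itv //.
  rewrite [X in (_ * X <= _)%E]lebesgue_measure_ball_itv // -EFinM lee_fin.
  by rewrite le_eqVlt; apply/orP; left; apply/eqP; ring.
Qed.

End FrameArea.

(** * Areas of planar regions *)

Section FrameAreaCut.
Context {R : realType} {n : nat}.
Implicit Types (u v : 'rV[R]_n) (D : set (R * R)) (z : R * R) (k x y : R).

Lemma frame_area_ge0 u v D : (0 <= frame_area u v D)%E.
Proof. exact: hausdorff_measure_ge0. Qed.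

Lemma le_frame_area u v D D' : D `<=` D' -> (frame_area u v D <= frame_area u v D')%E.
Proof. by move=> DD; apply: le_hausdorff_measure; exact: image_subset. Qed.

Lemma frame_areaU u v D D' :
  (frame_area u v (D `|` D') <= frame_area u v D + frame_area u v D')%E.
Proof. by rewrite /frame_area image_setU hausdorff_measureU. Qed.

(** Common source of the invariances below: the Lipschitz comparison is applied with ratio [k] one
    way and [k^-1] the other way. The right inverse [beta] makes [alpha] reach all of [D']. *)
Lemma frame_area_similar (n' : nat) (u' v' : 'rV[R]_n') u v D D'
    (alpha beta : R * R -> R * R) k : 0 < k ->
  cancel beta alpha -> (forall z, D' (alpha z) <-> D z) ->
  (forall p q, enorm (frame_point u' v' (alpha p) - frame_point u' v' (alpha q)) =
     k * enorm (frame_point u v p - frame_point u v q)) ->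
  frame_area u' v' D' = ((k ^+ 2)%:E * frame_area u v D)%E.
Proof.
move=> k0 ba DD iso.
have E : frame_point u' v' @` D' = (frame_point u' v' \o alpha) @` D.
  apply/seteqP; split => _ [z Dz <-].
    by exists (beta z); rewrite /= ?ba //; apply/DD; rewrite ba.
  by exists (alpha z) => //; apply/DD.
rewrite /frame_area E; apply/eqP; rewrite eq_le; apply/andP; split.
  by apply: hausdorff_measure_image => // p q _ _; rewrite iso.
rewrite -lee_pdivlMl ?exprn_gt0 // -exprVn; apply: hausdorff_measure_image.
  by rewrite invr_gt0.
by move=> p q _ _; rewrite /= iso mulKf ?gt_eqF.
Qed.

Lemma frame_area_isometric (n' : nat) (u' v' : 'rV[R]_n') u v D D'
    (alpha beta : R * R -> R * R) :
  cancel beta alpha -> (forall z, D' (alpha z) <-> D z) ->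
  (forall p q, enorm (frame_point u' v' (alpha p) - frame_point u' v' (alpha q)) =
     enorm (frame_point u v p - frame_point u v q)) ->
  frame_area u' v' D' = frame_area u v D.
Proof.
move=> ba DD iso.
have := @frame_area_similar _ u' v' u v D D' _ _ 1 ltr01 ba DD.
by rewrite expr1n mul1e; apply => p q; rewrite mul1r.
Qed.

Lemma frame_area_translate u v D D' x y :
  (forall z, D' (z.1 + x, z.2 + y) <-> D z) -> frame_area u v D' = frame_area u v D.
Proof.
move=> DD; apply: (@frame_area_isometric _ _ _ _ _ _ _ (fun z => (z.1 + x, z.2 + y))
  (fun z => (z.1 - x, z.2 - y))) => //.
  by move=> [s t] /=; rewrite !subrK.
by move=> p q; rewrite !frame_pointB /=; congr (enorm (frame_point _ _ (_, _))); ring.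
Qed.

Lemma frame_area_reflect u v D D' x y :
  (forall z, D' (x - z.1, y - z.2) <-> D z) -> frame_area u v D' = frame_area u v D.
Proof.
move=> DD; apply: (@frame_area_isometric _ _ _ _ _ _ _ (fun z => (x - z.1, y - z.2))
  (fun z => (x - z.1, y - z.2))) => //.
  by move=> [s t] /=; rewrite !subKr.
move=> p q; rewrite enormBC !frame_pointB /=.
by congr (enorm (frame_point _ _ (_, _))); ring.
Qed.

Lemma frame_area_dilate u v D D' k : 0 < k ->
  (forall z, D' (k * z.1, k * z.2) <-> D z) ->
  frame_area u v D' = ((k ^+ 2)%:E * frame_area u v D)%E.
Proof.
move=> k0 DD; have kn0 : k != 0 by rewrite gt_eqF.
apply: (@frame_area_similar _ _ _ _ _ _ _ (fun z => (k * z.1, k * z.2))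
  (fun z => (k^-1 * z.1, k^-1 * z.2))) => //.
  by move=> [s t] /=; rewrite !mulVKf.
move=> p q; rewrite !frame_pointB /= -!mulrBr.
by rewrite frame_pointZ enormZ gtr0_norm.
Qed.

Lemma frame_area_swap u v D D' : (forall z, D' (z.2, z.1) <-> D z) ->
  frame_area v u D' = frame_area u v D.
Proof.
move=> DD; apply: (@frame_area_isometric _ _ _ _ _ _ _ (fun z => (z.2, z.1))
  (fun z => (z.2, z.1))) => //; first by case.
by move=> p q; rewrite !frame_pointB /frame_point /= addrC.
Qed.

Lemma frame_area_scale_frame u v D D' k l : k != 0 -> l != 0 ->
  (forall z, D' (z.1 / k, z.2 / l) <-> D z) ->
  frame_area (k *: u) (l *: v) D' = frame_area u v D.
Proof.
move=> k0 l0 DD; apply: (@frame_area_isometric _ _ _ _ _ _ _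
  (fun z => (z.1 / k, z.2 / l)) (fun z => (z.1 * k, z.2 * l))) => //.
  by move=> [s t] /=; rewrite !mulfK.
move=> p q; rewrite !frame_pointB /frame_point /= !scalerA.
by rewrite -!mulrBl !divfK.
Qed.

(** Only the coordinates change: both sides describe the same points of the plane. *)
Lemma frame_area_shear_frame u v D D' k :
  (forall z, D' (z.1 + k * z.2, z.2) <-> D z) ->
  frame_area u (v - k *: u) D' = frame_area u v D.
Proof.
move=> DD; apply: (@frame_area_isometric _ _ _ _ _ _ _
  (fun z => (z.1 + k * z.2, z.2)) (fun z => (z.1 - k * z.2, z.2))) => //.
  by move=> [s t] /=; rewrite subrK.
move=> p q; rewrite !frame_pointB /frame_point /=; congr enorm.
have -> : p.1 + k * p.2 - (q.1 + k * q.2) = p.1 - q.1 + k * (p.2 - q.2) by ring.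
rewrite scalerBr scalerA scalerDl -addrA; congr (_ + _).
by rewrite addrCA (mulrC k) subrr addr0.
Qed.

Definition gram u v : R := dot u u * dot v v - dot u v ^+ 2.

(** A gap in coordinates is then a gap in Euclidean distance, as a cut requires. Completing the
    square in [dot v v * enorm (frame_point u v z) ^+ 2] leaves [z.1 ^+ 2 * gram u v] plus a square,
    and symmetrically for [z.2]; the numerator [dot u u + dot v v + 1] serves both coordinates. *)
Lemma frame_coord_le u v : 0 < gram u v -> exists2 C, 0 < C &
  forall z, `|z.1| <= C * enorm (frame_point u v z) /\
            `|z.2| <= C * enorm (frame_point u v z).
Proof.
move=> g0; have uu := dot_ge0 u; have vv := dot_ge0 v.
have s0 : 0 < (dot u u + dot v v + 1) / gram u v by rewrite divr_gt0 //; lra.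
exists (Num.sqrt ((dot u u + dot v v + 1) / gram u v)); first by rewrite sqrtr_gt0.
have sq (a b : R) : 0 <= b -> a ^+ 2 <= b ^+ 2 -> `|a| <= b.
  by move=> b0 ab; rewrite -(ger0_norm b0) -!sqrtr_sqr ler_sqrt // sqr_ge0.
move=> z; set e := enorm _.
have e2 : e ^+ 2 = z.1 ^+ 2 * dot u u + 2 * z.1 * z.2 * dot u v + z.2 ^+ 2 * dot v v.
  exact: sqr_enorm_frame_point.
have e0 : 0 <= e ^+ 2 by exact: sqr_ge0.
have b0 : 0 <= Num.sqrt ((dot u u + dot v v + 1) / gram u v) * e.
  by rewrite mulr_ge0 ?sqrtr_ge0 ?enorm_ge0.
have gE : gram u v = dot u u * dot v v - dot u v ^+ 2 by [].
split; apply: sq => //; rewrite exprMn sqr_sqrtr ?(ltW s0) //;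
  rewrite mulrAC ler_pdivlMr //.
  have h : dot v v * e ^+ 2 =
      (z.2 * dot v v + z.1 * dot u v) ^+ 2 + z.1 ^+ 2 * gram u v by rewrite e2 gE; ring.
  have := sqr_ge0 (z.2 * dot v v + z.1 * dot u v).
  have : 0 <= dot u u * e ^+ 2 by rewrite mulr_ge0.
  rewrite !mulrDl mul1r h; lra.
have h : dot u u * e ^+ 2 =
    (z.1 * dot u u + z.2 * dot u v) ^+ 2 + z.2 ^+ 2 * gram u v by rewrite e2 gE; ring.
have := sqr_ge0 (z.1 * dot u u + z.2 * dot u v).
have : 0 <= dot v v * e ^+ 2 by rewrite mulr_ge0.
rewrite !mulrDl mul1r h; lra.
Qed.

(** The part where [eps <= l] lies at distance at least [eps / C] from the part where [l <= 0], so
    these two areas add up; the layer between them contributes at most [eta]. *)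
Lemma frame_area_cut u v D (l : R * R -> R) C : 0 < C ->
  (forall p q, `|l p - l q| <= C * enorm (frame_point u v p - frame_point u v q)) ->
  (forall eta : R, 0 < eta -> exists2 eps : R, 0 < eps &
     (frame_area u v (D `&` [set z | (0 <= l z <= eps)%R]) <= eta%:E)%E) ->
  frame_area u v D = (frame_area u v (D `&` [set z | (l z <= 0)%R]) +
                      frame_area u v (D `&` [set z | (0 <= l z)%R]))%E.
Proof.
move=> C0 lip thin; apply/eqP; rewrite eq_le; apply/andP; split.
  rewrite -[X in (X <= _)%E](_ : frame_area u v (D `&` [set z | (l z <= 0)%R] `|`
    D `&` [set z | (0 <= l z)%R]) = frame_area u v D) ?frame_areaU //.
  congr frame_area; apply/seteqP; split => z /=; first by case=> -[].
  by move=> Dz; case: (leP (l z) 0) => lz; [left|right; split => //; exact: ltW].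
apply/lee_addgt0Pr => eta eta0; have [eps eps0 small] := thin eta eta0.
have up : (frame_area u v (D `&` [set z | (0 <= l z)%R]) <=
    frame_area u v (D `&` [set z | (eps <= l z)%R]) + eta%:E)%E.
  apply: (le_trans _ (leeD (lexx _) small)); apply: (le_trans _ (frame_areaU _ _ _ _)).
  apply: le_frame_area => z [Dz /= lz].
  case: (leP eps (l z)) => h; [by left|right; split => //=].
  by rewrite lz ltW.
apply: (le_trans (leeD (lexx _) up)); rewrite addeA leeD2r //.
apply: (le_trans _ (le_frame_area u v (_ : D `&` [set z | (l z <= 0)%R] `|`
   D `&` [set z | (eps <= l z)%R] `<=` D))); last by move=> z [[]|[]].
rewrite /frame_area image_setU.
apply: (@le_hausdorff_measureD _ _ _ (eps / C)); first by rewrite divr_gt0.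
move=> _ _ [p [_ /= lp] <-] [q [_ /= lq] <-].
rewrite ler_pdivrMr // mulrC (le_trans _ (lip p q)) //.
rewrite distrC (le_trans _ (ler_norm _)) //; lra.
Qed.

End FrameAreaCut.

Lemma frame_area_orthonormal_fin (R : realType) n (u v : 'rV[R]_n) :
  orthonormal_frame u v -> (frame_area u v (rect 0 1 0 1) < +oo)%E.
Proof.
move=> ouv; apply: self_similar_hausdorff_finite.
- exists (frame_point u v (0, 0)), (0, 0) => //.
  by split; rewrite /= lexx ler01.
- apply: (@le_lt_trans _ _ (2%:E)); last exact: ltry.
  apply: ge_ereal_sup => _ [_ [p [p1 p2] <-]] [_ [q [q1 q2] <-]] <-.
  rewrite lee_fin frame_pointB enorm_orthonormal //=.
  rewrite -(ger0_norm (@ler0n R 2)) -sqrtr_sqr ler_sqrt ?sqr_ge0 //.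
  move: p1 p2 q1 q2 => /andP[p1 p1'] /andP[p2 p2'] /andP[q1 q1'] /andP[q2 q2'].
  nra.
move=> delta; pose H := @hausdorff_content R n 2.
(* Four half-size copies cover the square. Each has, at half the scale, at most a quarter of the
   content, and the four quarters add up to 1. *)
pose quarter (x y : R) z := frame_point u v (z.1 / 2 + x, z.2 / 2 + y).
have quarterE x y : (H (delta / 2)%R (quarter x y @` rect 0 1 0 1) <=
    (4^-1)%:E * H delta (frame_point u v @` rect 0 1 0 1))%E.
  rewrite (mulrC delta).
  rewrite (_ : 4^-1 = 2^-1 ^+ 2 :> R); last by rewrite exprVn -natrX.
  rewrite /H; apply: (@hausdorff_content_image _ _ n n 2 delta _ (frame_point u v)) => // p q _ _.
  rewrite /quarter !frame_pointB /=.
  have -> : (p.1 / 2 + x - (q.1 / 2 + x), p.2 / 2 + y - (q.2 / 2 + y)) =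
     (2^-1 * (p.1 - q.1), 2^-1 * (p.2 - q.2)) by congr pair; ring.
  by rewrite frame_pointZ enormZ gtr0_norm // invr_gt0.
pose Q x y := quarter x y @` rect 0 1 0 1.
apply: (@le_trans _ _ (H (delta / 2)%R ((Q 0 0 `|` Q 0 2^-1) `|`
    (Q 2^-1 0 `|` Q 2^-1 2^-1)))).
  apply: le_hausdorff_content_set => _ [z [z1 z2] <-].
  move: z1 z2 => /andP[z1 z1'] /andP[z2 z2'].
  case: (leP z.1 2^-1) => h1; case: (leP z.2 2^-1) => h2;
    [left; left|left; right|right; left|right; right].
  - exists (2 * z.1, 2 * z.2).
      rewrite /rect /=; lra.
    by rewrite /quarter; congr frame_point; case: (z) => a b /=; congr pair; field.
  - exists (2 * z.1, 2 * z.2 - 1).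
      rewrite /rect /=; lra.
    by rewrite /quarter; congr frame_point; case: (z) => a b /=; congr pair; field.
  - exists (2 * z.1 - 1, 2 * z.2).
      rewrite /rect /=; lra.
    by rewrite /quarter; congr frame_point; case: (z) => a b /=; congr pair; field.
  - exists (2 * z.1 - 1, 2 * z.2 - 1).
      rewrite /rect /=; lra.
    by rewrite /quarter; congr frame_point; case: (z) => a b /=; congr pair; field.
apply: (le_trans (hausdorff_contentU _ _ _ _)).
apply: (le_trans (leeD (hausdorff_contentU _ _ _ _) (hausdorff_contentU _ _ _ _))).
apply: (le_trans (leeD (leeD (quarterE _ _) (quarterE _ _))
                       (leeD (quarterE _ _) (quarterE _ _)))).
have i4 : (0 <= (4^-1 : R)%:E)%E by rewrite lee_fin.
rewrite -!ge0_muleDl ?adde_ge0 // -!EFinD (_ : _ + _ = 1) ?mul1e //.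
by field.
Qed.

(** * Finite areas, thin strips and straight cuts *)

Section AreaFormula.
Context {R : realType} {n : nat}.
Context (e f : 'rV[R]_n) (oef : orthonormal_frame e f).
Implicit Types (u v : 'rV[R]_n) (D : set (R * R)) (z : R * R) (k x y p q : R).

Definition unit_area u v : R := fine (frame_area u v (rect 0 1 0 1)).

Lemma frame_area_unit_fin u v : frame_area u v (rect 0 1 0 1) \is a fin_num.
Proof.
rewrite ge0_fin_numE ?frame_area_ge0 //.
(* An upper bound for the quadratic form of the frame on unit coordinate vectors, made positive by
   the summand 1; its root is the Lipschitz constant relative to the orthonormal frame. *)
pose K := dot u u + `|dot u v| + dot v v + 1.
have K0 : 0 < K.
  by rewrite ltr_pwDr // !addr_ge0 ?dot_ge0.
have sK0 : 0 < Num.sqrt K by rewrite sqrtr_gt0.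
have lip (p q : R * R) : enorm (frame_point u v p - frame_point u v q) <=
    Num.sqrt K * enorm (frame_point e f p - frame_point e f q).
  rewrite !frame_pointB (enorm_orthonormal _ oef) /= -sqrtrM ?(ltW K0) //.
  rewrite -[leLHS]ger0_norm ?enorm_ge0 // -sqrtr_sqr ler_sqrt ?mulr_ge0 ?(ltW K0) //;
    last by rewrite addr_ge0 ?sqr_ge0.
  rewrite sqr_enorm_frame_point /=; set a := _ - _; set b := _ - _.
  have h1 : 2 * a * b * dot u v <= (a ^+ 2 + b ^+ 2) * `|dot u v|.
    apply: le_trans (ler_norm _) _; rewrite normrM ler_wpM2r // -mulrA normrM.
    rewrite ger0_norm // normrM -(real_normK (num_real a)) -(real_normK (num_real b)).
    have := sqr_ge0 (`|a| - `|b|); nra.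
  have := dot_ge0 u; have := dot_ge0 v; have := sqr_ge0 a; have := sqr_ge0 b.
  rewrite /K; nra.
have le_uv := @hausdorff_measure_image R _ n n 2 (rect 0 1 0 1) _ _ _ sK0
  (fun z w _ _ => lip z w).
apply: (le_lt_trans le_uv).
have := frame_area_orthonormal_fin oef; have := frame_area_ge0 e f (rect 0 1 0 1).
rewrite -/(frame_area e f _) => a0 afin.
by rewrite -[frame_area _ _ _]fineK ?ge0_fin_numE // -EFinM ltry.
Qed.

Lemma frame_area_unitE u v : frame_area u v (rect 0 1 0 1) = (unit_area u v)%:E.
Proof. by rewrite fineK // frame_area_unit_fin. Qed.

Lemma frame_area_square u v x y k : 0 < k ->
  frame_area u v (rect x (x + k) y (y + k)) = (k ^+ 2 * unit_area u v)%:E.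
Proof.
move=> k0; rewrite EFinM -frame_area_unitE.
rewrite -(@frame_area_dilate _ _ _ _ _ (rect 0 k 0 k) _ k0).
  apply: (@frame_area_translate _ _ _ _ _ _ x y) => z; rewrite /rect /=.
  by split=> -[/andP[a b] /andP[c d]]; split; lra.
by move=> z; rewrite /rect /= !ger_pMr // !pmulr_rge0.
Qed.

(** The strip is a stack of [N.+1] squares of side [k / N.+1%:R], of total area [k ^+ 2 / N.+1%:R]
    times [unit_area u v]. Only subadditivity enters, so the bound is available before any cut. *)
Lemma frame_area_strip_le u v x y k N :
  0 < k -> (frame_area u v (rect x (x + k / N.+1%:R) y (y + k)) <=
            (k ^+ 2 * unit_area u v / N.+1%:R)%:E)%E.
Proof.
move=> k0; have N0 : 0 < N.+1%:R :> R by rewrite ltr0Sn.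
pose h := k / N.+1%:R; have h0 : 0 < h by rewrite divr_gt0.
have piece j : (frame_area u v (rect x (x + h) y (y + j.+1%:R * h)) <=
    (j.+1%:R * (h ^+ 2 * unit_area u v))%:E)%E.
  elim: j => [|j IH]; first by rewrite !mul1r frame_area_square.
  have -> : (j.+2%:R * (h ^+ 2 * unit_area u v))%:E =
      ((j.+1%:R * (h ^+ 2 * unit_area u v))%:E + (h ^+ 2 * unit_area u v)%:E)%E.
    by rewrite -EFinD -[j.+2%:R]natr1 mulrDl mul1r.
  rewrite -(frame_area_square u v x (y + j.+1%:R * h) h0).
  apply: (le_trans _ (leeD IH (lexx _))); apply: (le_trans _ (frame_areaU _ _ _ _)).
  apply: le_frame_area => z [/= zx]; rewrite -[j.+2%:R]natr1 mulrDl mul1r addrA => zy.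
  by case: (leP z.2 (y + j.+1%:R * h)) => zj; [left|right]; split => //=;
    move: zy => /andP[zy1 zy2]; apply/andP; split => //; exact: ltW.
have := piece N; rewrite /h [N.+1%:R * (k / _)]mulrC divfK ?gt_eqF //.
congr (_ <= EFin _)%E; by field; rewrite gt_eqF.
Qed.

Lemma frame_area_thin_strip u v x y k eta : 0 < k -> 0 < eta -> exists2 eps, 0 < eps &
  (frame_area u v (rect x (x + eps) y (y + k)) <= eta%:E)%E.
Proof.
move=> k0 eta0; pose N := Num.truncn (k ^+ 2 * unit_area u v / eta).
exists (k / N.+1%:R); first by rewrite divr_gt0 // ltr0Sn.
apply: (le_trans (frame_area_strip_le _ _ _ _ _ k0)).
rewrite lee_fin ler_pdivrMr ?ltr0Sn // [leRHS]mulrC -ler_pdivrMr //.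
exact/ltW/truncnS_gt.
Qed.

Lemma frame_area_cut_coord u v D c y k : 0 < gram u v -> 0 < k ->
  D `<=` [set z | y <= z.2 <= y + k] ->
  frame_area u v D = (frame_area u v (D `&` [set z | (z.1 <= c)%R]) +
                      frame_area u v (D `&` [set z | (c <= z.1)%R]))%E.
Proof.
move=> g0 k0 Dy; have [C C0 Cz] := frame_coord_le g0.
have -> : [set z : R * R | z.1 <= c] = [set z | z.1 - c <= 0].
  by apply/seteqP; split => z /=; rewrite subr_le0.
have -> : [set z : R * R | c <= z.1] = [set z | 0 <= z.1 - c].
  by apply/seteqP; split => z /=; rewrite subr_ge0.
apply: (@frame_area_cut _ _ _ _ _ (fun z => z.1 - c) C) => // [p q|eta eta0].
  by rewrite frame_pointB opprB addrA subrK; case: (Cz (p.1 - q.1, p.2 - q.2)).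
have [eps eps0 small] := frame_area_thin_strip u v c y k0 eta0.
exists eps => //; apply: le_trans small; apply: le_frame_area => z [/Dy zy /= zc].
by split => //; lra.
Qed.

Lemma gram_shear u v k : gram u (v - k *: u) = gram u v.
Proof.
by rewrite /gram -scaleNr !(dotDl, dotDr, dotZl, dotZr) (dotC v u); ring.
Qed.

(** In the sheared frame [u], [v - u] the first coordinate of the same point is [z.1 + z.2], so the
    oblique cut becomes a coordinate cut. *)
Lemma frame_area_cut_diag u v D c y k : 0 < gram u v -> 0 < k ->
  D `<=` [set z | y <= z.2 <= y + k] ->
  frame_area u v D = (frame_area u v (D `&` [set z | (z.1 + z.2 <= c)%R]) +
                      frame_area u v (D `&` [set z | (c <= z.1 + z.2)%R]))%E.
Proof.
move=> g0 k0 Dy.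
have shear (E : set (R * R)) :
    frame_area u v E = frame_area u (v - 1 *: u) [set z | E (z.1 - z.2, z.2)].
  symmetry; apply: frame_area_shear_frame => z /=.
  by rewrite mul1r addrK -surjective_pairing.
rewrite !shear (@frame_area_cut_coord _ _ _ c y k) ?gram_shear //; last first.
  by move=> z /= /Dy.
by congr (_ + _)%E; congr frame_area; apply/seteqP; split => z /=; rewrite subrK.
Qed.

(** Cauchy's functional equation: nonnegativity and additivity make [g] monotone, which excludes
    irregular solutions. *)
Lemma additive_monotone_linear (g : R -> R) : (forall p, 0 < p -> 0 <= g p) ->
  (forall p q, 0 < p -> 0 < q -> g (p + q) = g p + g q) ->
  forall p, 0 < p -> g p = p * g 1.
Proof.
move=> g0 gD; have gn p j : 0 < p -> g (j.+1%:R * p) = j.+1%:R * g p.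
  move=> p0; elim: j => [|j IH]; first by rewrite !mul1r.
  by rewrite -[j.+2%:R]natr1 mulrDl mul1r gD ?mulr_gt0 // IH mulrDl mul1r.
have glt p q : 0 < p -> p < q -> g p <= g q.
  move=> p0 pq; rewrite -[q](subrK p) addrC gD ?subr_gt0 //.
  by rewrite lerDl g0 ?subr_gt0.
have gle p q : 0 < p -> p <= q -> g p <= g q.
  by move=> p0; rewrite le_eqVlt => /orP[/eqP -> //|]; exact: glt.
move=> p p0; have g1 := g0 1 ltr01.
apply/eqP; rewrite -subr_eq0 -normr_eq0; apply/negPn/negP => neq.
have d0 : 0 < `|g p - p * g 1| by rewrite lt_neqAle eq_sym neq normr_ge0.
pose N := Num.truncn (Num.max (p^-1) (g 1 / `|g p - p * g 1|)).
have : Num.max (p^-1) (g 1 / `|g p - p * g 1|) < N.+1%:R by exact: truncnS_gt.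
have NR : 0 < N.+1%:R :> R by rewrite ltr0Sn.
rewrite gt_max ltr_pdivrMr // => /andP[N1 N2].
have Np : 1 < N.+1%:R * p by rewrite -ltr_pdivrMr // div1r.
(* With [M.+1] the integer part of [N.+1%:R * p], both [N.+1%:R * g p] and [N.+1%:R * p * g 1] lie
   between [M.+1] and [M.+2] times [g 1]. Hence they differ by at most [g 1], whereas [N] was chosen
   to make the difference larger. *)
have := truncn_itv (ltW (lt_trans ltr01 Np)).
case: (Num.truncn _) => [|M] /andP[M1 M2]; first by move: M2; rewrite ltNge (ltW Np).
have lo : M.+1%:R * g 1 <= N.+1%:R * g p.
  by rewrite -!gn // gle // mulr1.
have up : N.+1%:R * g p <= (M.+1%:R + 1) * g 1.
  by rewrite natr1 -!gn // gle ?mulr_gt0 // mulr1 ltW.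
have M2' : N.+1%:R * p <= M.+1%:R + 1 by rewrite natr1 ltW.
have : N.+1%:R * `|g p - p * g 1| <= g 1.
  rewrite -{1}(gtr0_norm NR) -normrM ler_norml mulrBr mulrA; apply/andP; split.
    have : N.+1%:R * p * g 1 <= (M.+1%:R + 1) * g 1 by rewrite ler_wpM2r.
    lra.
  have : M.+1%:R * g 1 <= N.+1%:R * p * g 1 by rewrite ler_wpM2r.
  lra.
by rewrite leNgt N2.
Qed.
End AreaFormula.

(** * Rectangles, triangles and the Gram determinant *)

Section GramFormula.
Context {R : realType} {n : nat}.
Context (e f : 'rV[R]_n) (oef : orthonormal_frame e f).
Implicit Types (u v : 'rV[R]_n) (D : set (R * R)) (z : R * R) (k x y p q : R).

Let rect_area u v p q := fine (frame_area u v (rect 0 p 0 q)).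

Let rect_area_fin u v p q : 0 < p -> 0 < q ->
  frame_area u v (rect 0 p 0 q) \is a fin_num.
Proof.
move=> p0 q0; rewrite ge0_fin_numE ?frame_area_ge0 //.
have pq : 0 < p + q by rewrite addr_gt0.
apply: (@le_lt_trans _ _ (frame_area u v (rect 0 (0 + (p + q)) 0 (0 + (p + q))))).
  by apply: le_frame_area => z [/andP[a b] /andP[c d]]; split; lra.
by rewrite (frame_area_square oef) // ltry.
Qed.

Let rect_areaD u v q p p' : 0 < gram u v -> 0 < q -> 0 < p -> 0 < p' ->
  rect_area u v (p + p') q = rect_area u v p q + rect_area u v p' q.
Proof.
move=> g0 q0 p0 p'0; rewrite /rect_area.
rewrite (frame_area_cut_coord oef (D := rect _ _ _ _) p (y := 0) g0 q0); last first.
  by move=> z [_]; rewrite /= add0r.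
rewrite (_ : rect 0 (p + p') 0 q `&` _ = rect 0 p 0 q); last first.
  apply/seteqP; split => z [] /=; rewrite /rect /=.
    by move=> [/andP[a b] c] d; split => //; lra.
  by move=> /andP[a b] c; do ! split => //; lra.
rewrite [X in (_ + X)%E](_ : _ = frame_area u v (rect 0 p' 0 q)).
  by rewrite fineD // rect_area_fin.
apply: (@frame_area_translate _ _ _ _ _ _ p 0) => z; rewrite /rect /= addr0.
split; first by move=> [[/andP[a b] c] d]; split => //; lra.
by move=> [/andP[a b] c]; do ! split => //; lra.
Qed.

Let rect_area_linear u v q p : 0 < gram u v -> 0 < q -> 0 < p ->
  rect_area u v p q = p * rect_area u v 1 q.
Proof.
move=> g0 q0; apply: (@additive_monotone_linear _ (fun p => rect_area u v p q)).
  by move=> p' _; rewrite fine_ge0 // frame_area_ge0.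
by move=> p' p''; exact: rect_areaD.
Qed.

Let rect_area_swap u v p q : rect_area u v p q = rect_area v u q p.
Proof.
congr fine; apply: frame_area_swap => z; rewrite /rect /=.
by split; case.
Qed.

Lemma gramC u v : gram u v = gram v u.
Proof. by rewrite /gram mulrC dotC. Qed.

(** For a fixed height the area is additive and nonnegative in the width, hence linear; swapping the
    frame gives linearity in the height. *)
Lemma frame_area_rect u v x y p q : 0 < gram u v -> 0 < p -> 0 < q ->
  frame_area u v (rect x (x + p) y (y + q)) = (p * q * unit_area u v)%:E.
Proof.
move=> g0 p0 q0.
rewrite (@frame_area_translate _ _ u v (rect 0 p 0 q) _ x y); last first.
  by move=> z; rewrite /rect /=; split => -[/andP[a b] /andP[c d]]; split; lra.
rewrite -(fineK (rect_area_fin _ _ p0 q0)) -/(rect_area u v p q); congr EFin.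
have g0' : 0 < gram v u by rewrite gramC.
rewrite (rect_area_linear g0 q0 p0) (rect_area_swap u v 1 q).
rewrite (rect_area_linear g0' ltr01 q0) (rect_area_swap v u 1 1).
by rewrite mulrA.
Qed.

Definition triangle k : set (R * R) := [set z | [/\ 0 <= z.1, 0 <= z.2 & z.1 + z.2 <= k]].

(** The diagonal cut splits the square of side [k] into two triangles that the point reflection
    through its centre exchanges. *)
Lemma frame_area_triangle u v k : 0 < gram u v -> 0 < k ->
  frame_area u v (triangle k) = (k ^+ 2 / 2 * unit_area u v)%:E.
Proof.
move=> g0 k0.
have sq := frame_area_square oef u v 0 0 k0.
have fin : frame_area u v (triangle k) \is a fin_num.
  rewrite ge0_fin_numE ?frame_area_ge0 //.
  apply: (@le_lt_trans _ _ (frame_area u v (rect 0 (0 + k) 0 (0 + k)))).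
    by apply: le_frame_area => z [a b c]; split; lra.
  by rewrite sq ltry.
move: sq; rewrite (frame_area_cut_diag oef (D := rect _ _ _ _) k (y := 0) g0 k0); last first.
  by move=> z [_].
rewrite (_ : rect 0 (0 + k) 0 (0 + k) `&` _ = triangle k); last first.
  apply/seteqP; split => z; rewrite /triangle /rect /=.
    by move=> [[/andP[a b] /andP[c d]] h]; split.
  by move=> [a b c]; do ! split => //; lra.
rewrite [X in (_ + X)%E](_ : _ = frame_area u v (triangle k)); last first.
  apply: (@frame_area_reflect _ _ _ _ _ _ k k) => z; rewrite /triangle /rect /=.
  split; first by move=> [[/andP[a b] /andP[c d]] h]; split; lra.
  by move=> [a b c]; do ! split => //; lra.
rewrite -(fineK fin) -EFinD => -[h]; congr EFin.
by apply: (@mulIf _ 2) => //; rewrite mulr_natr mulr2n h; field.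
Qed.

Lemma unit_area_oppl u v : unit_area (- u) v = unit_area u v.
Proof.
congr fine; apply: (@frame_area_isometric _ _ _ _ _ _ _ _ _ (fun z => (1 - z.1, z.2))
  (fun z => (1 - z.1, z.2))).
- by move=> [s t] /=; rewrite subKr.
- by move=> z; rewrite /rect /=; split => -[/andP[a b] c]; split => //; lra.
move=> z w; rewrite !frame_pointB /=; congr enorm.
rewrite /frame_point /= scalerN -scaleNr.
by have -> : - (1 - z.1 - (1 - w.1)) = z.1 - w.1 by ring.
Qed.

Lemma unit_areaZl u v k : 0 < gram u v -> 0 < k ->
  unit_area (k *: u) v = k * unit_area u v.
Proof.
move=> g0 k0; have kn0 : k != 0 by rewrite gt_eqF.
have := frame_area_rect 0 0 g0 k0 ltr01; rewrite mulr1 => /(congr1 fine) /= <-.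
congr fine; rewrite -[in LHS](scale1r v).
apply: frame_area_scale_frame => // z; rewrite divr1 /rect /= !add0r.
by rewrite ler_pdivrMr // mul1r pmulr_lge0 // invr_gt0.
Qed.

Lemma unit_areaC u v : unit_area u v = unit_area v u.
Proof. by congr fine; apply: frame_area_swap => z; rewrite /rect /=; split; case. Qed.

(* The diagonal from [u] to [v] halves the parallelogram of [u] and [v], and the
   triangle with vertices 0, u, v seen from the vertex u is spanned by -u and v - u. *)
Lemma unit_area_shear1 u v : 0 < gram u v -> unit_area u (v - u) = unit_area u v.
Proof.
move=> g0; rewrite -(unit_area_oppl u (v - u)).
have g1 : 0 < gram (- u) (v - u).
  rewrite (_ : gram _ _ = gram u v) // /gram -(scaleN1r u).
  by rewrite !(dotDl, dotDr, dotZl, dotZr) (dotC v u); ring.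
have := frame_area_triangle g1 ltr01; have := frame_area_triangle g0 ltr01.
rewrite (@frame_area_isometric _ _ _ u v (- u) (v - u) (triangle 1) _
  (fun z => (1 - z.1 - z.2, z.2)) (fun z => (1 - z.1 - z.2, z.2))).
- by move=> -> [/mulfI]; rewrite expr1n mul1r => -> //; rewrite invr_neq0.
- by move=> [s t] /=; congr pair; ring.
- by move=> z; rewrite /triangle /=; split => -[a b c]; split; lra.
move=> z w; rewrite !frame_pointB /=; congr enorm; rewrite /frame_point /=.
have -> : 1 - z.1 - z.2 - (1 - w.1 - w.2) = - (z.1 - w.1) - (z.2 - w.2) by ring.
by rewrite scalerN scalerBr scalerBl scaleNr -addrA [- _ + _ *: v]addrC.
Qed.

(** For positive [k], multiplying both sides by [k] rescales [u] to [k *: u] and reduces the claim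
    to a shear by 1; for negative [k], replace [u] by [- u]. *)
Lemma unit_area_shear u v k : 0 < gram u v -> unit_area u (v - k *: u) = unit_area u v.
Proof.
have pos u' v' k' : 0 < k' -> 0 < gram u' v' ->
    unit_area u' (v' - k' *: u') = unit_area u' v'.
  move=> k0 g0; have g1 : 0 < gram (k' *: u') v'.
    rewrite (_ : gram _ _ = k' ^+ 2 * gram u' v') ?mulr_gt0 ?exprn_gt0 //.
    by rewrite /gram !(dotZl, dotZr); ring.
  apply: (@mulfI _ k'); first by rewrite gt_eqF.
  by rewrite -!unit_areaZl ?gram_shear // unit_area_shear1.
move=> g0; case: (ltrgt0P k) => [k0|k0|->]; last by rewrite scale0r subr0.
  exact: pos.
have gN : gram (- u) v = gram u v by rewrite -scaleN1r /gram !(dotZl, dotZr); ring.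
have := pos (- u) v (- k); rewrite oppr_gt0 gN => /(_ k0 g0).
by rewrite scaleNr scalerN opprK !unit_area_oppl.
Qed.

Lemma unit_area_orthonormal u v : orthonormal_frame u v -> unit_area u v = unit_area e f.
Proof.
move=> ouv; congr fine; apply: (@frame_area_isometric _ _ _ _ _ _ _ _ _ id id) => //.
by move=> z w; rewrite !frame_pointB !enorm_orthonormal.
Qed.

(** Gram-Schmidt: a shear replaces [v] by its component [w] orthogonal to [u], keeping both the area
    and the Gram determinant; homogeneity in each vector then leads to an orthonormal frame. *)
Lemma unit_area_gram u v : 0 < gram u v ->
  unit_area u v = Num.sqrt (gram u v) * unit_area e f.
Proof.
move=> g0; have uu : 0 < dot u u.
  rewrite lt_neqAle dot_ge0 andbT; apply: contraTneq g0 => uu0.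
  by rewrite /gram -uu0 mul0r sub0r oppr_gt0 -leNgt sqr_ge0.
pose w := v - (dot u v / dot u u) *: u.
have uw : dot u w = 0.
  by rewrite /w -scaleNr dotDr dotZr mulNr divfK ?gt_eqF // subrr.
have guw : gram u w = gram u v by rewrite gram_shear.
have wwE : dot u u * dot w w = gram u v by rewrite -guw /gram uw expr0n subr0.
have ww : 0 < dot w w by rewrite -(pmulr_rgt0 _ uu) wwE.
have [su sw] : 0 < enorm u /\ 0 < enorm w by rewrite !sqrtr_gt0.
rewrite -(unit_area_shear (dot u v / dot u u) g0) -/w.
have onf : orthonormal_frame ((enorm u)^-1 *: u) ((enorm w)^-1 *: w).
  split; rewrite !(dotZl, dotZr) ?uw ?mulr0 //.
    by rewrite -sqr_enorm; field; rewrite gt_eqF.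
  by rewrite -sqr_enorm; field; rewrite gt_eqF.
rewrite -(unit_area_orthonormal onf) -wwE sqrtrM ?dot_ge0 // -/(enorm u) -/(enorm w).
have g' u' w' k : orthonormal_frame u' w' -> 0 < k -> 0 < gram u' (k *: w').
  case=> uu1 ww1 uw0 k0.
  by rewrite /gram !(dotZl, dotZr) uw0 ww1 uu1
    !(mul1r, mulr1, mulr0, subr0, expr0n) mulr_gt0.
move: (g' _ _ (enorm w) onf sw) (g' _ _ 1 onf ltr01); set u' := _ *: u; set w' := _ *: w.
rewrite scale1r => gw g1.
rewrite -{1}[u](_ : enorm u *: u' = u); last by rewrite scalerA mulfV ?gt_eqF // scale1r.
rewrite -{1}[w](_ : enorm w *: w' = w); last by rewrite scalerA mulfV ?gt_eqF // scale1r.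
rewrite gramC in g1.
rewrite (unit_areaZl gw su) (unit_areaC u' (_ *: w')) (unit_areaZl g1 sw).
by rewrite (unit_areaC w' u') mulrA.
Qed.
End GramFormula.

(** * Volumes of the central sections *)

(** The symmetries of the cube, written in the shape that [k_diagonal_direction] uses. *)
Definition signed_perm (R : realType) n (s : 'S_n) (e : 'I_n -> bool) (x : 'rV[R]_n) :
    'rV[R]_n :=
  \row_i ((-1) ^+ e i * x 0 (s i)).

Section SignedPerm.
Context {R : realType} {n : nat}.
Implicit Types (s : 'S_n) (e : 'I_n -> bool) (x y a : 'rV[R]_n).

Lemma signed_permK s e :
  cancel (signed_perm s e) (@signed_perm R n s^-1%g (e \o (s^-1)%g)).
Proof.
move=> x; apply/rowP => i; rewrite !mxE /= permKV mulrA -signr_addb addbb.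
by rewrite expr0 mul1r.
Qed.

Lemma signed_permVK s e :
  cancel (@signed_perm R n s^-1%g (e \o (s^-1)%g)) (signed_perm s e).
Proof.
move=> x; apply/rowP => i; rewrite !mxE /= permK mulrA -signr_addb addbb.
by rewrite expr0 mul1r.
Qed.

Lemma signed_permB s e x y :
  signed_perm s e (x - y) = signed_perm s e x - signed_perm s e y.
Proof. by apply/rowP => i; rewrite !mxE mulrBr. Qed.

Lemma dot_signed_perm s e x y : dot (signed_perm s e x) (signed_perm s e y) = dot x y.
Proof.
rewrite /dot (reindex_inj (@perm_inj _ s^-1%g)); apply: eq_bigr => i _.
by rewrite !mxE permKV mulrACA -signr_addb addbb expr0 mul1r.
Qed.

Lemma enorm_signed_perm s e x : enorm (signed_perm s e x) = enorm x.
Proof. by rewrite /enorm dot_signed_perm. Qed.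

Lemma cube_signed_perm s e x : cube R n x -> cube R n (signed_perm s e x).
Proof.
move=> cx i; rewrite mxE -ler_norml normrM normr_sign mul1r ler_norml; exact: cx.
Qed.

Lemma section_volume_signed_perm s e a :
  section_volume (signed_perm s e a) = section_volume a.
Proof.
congr fine; set g := signed_perm s e; set D := cube R n `&` perp a.
have lip (x y : 'rV[R]_n) : enorm (g x - g y) = 1 * enorm (id x - id y).
  by rewrite /g -signed_permB enorm_signed_perm mul1r.
have -> : cube R n `&` perp (g a) = g @` D.
  apply/seteqP; split => y.
    move=> [cy py]; exists (signed_perm s^-1%g (e \o (s^-1)%g) y); last exact: signed_permVK.
    split; first exact: cube_signed_perm.
    rewrite /perp /=; rewrite -(dot_signed_perm s e) signed_permVK; exact: py.
  move=> [x [cx px] <-]; split; first exact: cube_signed_perm.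
  by rewrite /perp /= dot_signed_perm.
have E : D = id @` D by rewrite image_id.
rewrite [in RHS]E; apply/eqP; rewrite eq_le; apply/andP; split.
  have /= := @hausdorff_measure_image R _ n n n.-1 D id g 1 ltr01.
  rewrite expr1n mul1e; apply => p q _ _; by rewrite lip.
have /= := @hausdorff_measure_image R _ n n n.-1 D g id 1 ltr01.
by rewrite expr1n mul1e; apply => p q _ _; rewrite lip !mul1r.
Qed.

End SignedPerm.

(** Two opposite corner triangles with legs [p + q - c] are cut off a rectangle with sides [2 * p]
    and [2 * q]. The last two inequalities say that the legs do not exceed these sides. *)
Lemma hexagon_area (R : realType) n (e f u v : 'rV[R]_n) (p q c : R) :
  orthonormal_frame e f ->
  0 < gram u v -> 0 < p -> 0 < q -> 0 < c -> c < p + q -> p <= q + c -> q <= p + c ->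
  frame_area u v [set z | [/\ `|z.1| <= p, `|z.2| <= q & `|z.1 + z.2| <= c]] =
  ((4 * p * q - (p + q - c) ^+ 2) * unit_area u v)%:E.
Proof.
move=> oef g0 p0 q0 c0 d0 pqc qpc; rewrite -subr_gt0 in d0.
have q20 : 0 < 2 * q by rewrite mulr_gt0.
have := frame_area_rect oef (- p) (- q) g0 (mulr_gt0 (ltr0Sn _ 1) p0) q20.
have -> : - p + 2 * p = p by ring.
have -> : - q + 2 * q = q by ring.
have sub D : D `<=` rect (- p) p (- q) q ->
    D `<=` [set z | - q <= z.2 <= - q + 2 * q].
  by move=> DR z /DR [_] /= /andP[a b]; apply/andP; split; lra.
rewrite (frame_area_cut_diag oef (D := rect _ _ _ _) c (y := - q) g0 q20); last exact: sub.
rewrite [X in (_ + X)%E = _](_ : _ = frame_area u v (triangle (p + q - c))); last first.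
  apply: (@frame_area_reflect _ _ _ _ _ _ p q) => z; rewrite /triangle /rect /=.
  split; first by move=> [[/andP[a b] /andP[a' b']] h]; split; lra.
  by move=> [a b h]; do ! split => //; lra.
rewrite (frame_area_cut_diag oef (D := _ `&` _) (- c) (y := - q) g0 q20); last first.
  by apply: sub => z [].
rewrite [X in (X + _ + _)%E = _](_ : _ = frame_area u v (triangle (p + q - c))); last first.
  apply: (@frame_area_translate _ _ _ _ _ _ (- p) (- q)) => z; rewrite /triangle /rect /=.
  split; first by move=> [[[/andP[a b] /andP[a' b']] h] h']; split; lra.
  by move=> [a b h]; do ! split => //; lra.
rewrite (_ : rect _ _ _ _ `&` _ `&` _ =
    [set z | [/\ `|z.1| <= p, `|z.2| <= q & `|z.1 + z.2| <= c]]); last first.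
  apply/seteqP; split => z; rewrite /rect /= !ler_norml.
    by move=> [[[a b] h] h']; split => //; rewrite h'.
  by move=> [a b /andP[h h']].
rewrite (frame_area_triangle oef) //.
set H := frame_area _ _ _; have H0 : (0 <= H)%E by exact: frame_area_ge0.
case: H H0 => [h _||//]; last by rewrite addey.
rewrite -!EFinD => -[hE]; congr EFin; move: hE; set d := p + q - c; set g := unit_area u v.
move=> hE; have -> : h = 2 * p * (2 * q) * g - d ^+ 2 / 2 * g * 2 by rewrite -hE; ring.
by field.
Qed.

Lemma ord2P (P : 'I_2 -> Prop) : P (inord 0) -> P (inord 1) -> forall i, P i.
Proof.
move=> P0 P1 i; rewrite -(inord_val i).
by case: i => -[|[|m]] //= im.
Qed.

Lemma ord3P (P : 'I_3 -> Prop) :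
  P (inord 0) -> P (inord 1) -> P (inord 2) -> forall i, P i.
Proof.
move=> P0 P1 P2 i; rewrite -(inord_val i).
by case: i => -[|[|[|m]]] //= im.
Qed.

Lemma big_ord2 (V : nmodType) (F : 'I_2 -> V) :
  \sum_(i < 2) F i = F (inord 0) + F (inord 1).
Proof.
rewrite !big_ord_recl big_ord0 addr0; congr (F _ + F _); apply/val_inj; by rewrite /= inordK.
Qed.

Lemma big_ord3 (V : nmodType) (F : 'I_3 -> V) :
  \sum_(i < 3) F i = F (inord 0) + F (inord 1) + F (inord 2).
Proof.
rewrite !big_ord_recl big_ord0 addr0 addrA; congr (F _ + F _ + F _);
  apply/val_inj; by rewrite /= inordK.
Qed.

(** * Explicit sections in dimensions two and three *)

Section Sections.
Context {R : realType}.
Implicit Types (x y z : R).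

Definition vec2 x y : 'rV[R]_2 := \row_i [:: x; y]`_i.
Definition vec3 x y z : 'rV[R]_3 := \row_i [:: x; y; z]`_i.

Lemma dot2E (a b : 'rV[R]_2) : dot a b =
  a 0 (inord 0) * b 0 (inord 0) + a 0 (inord 1) * b 0 (inord 1).
Proof. exact: big_ord2. Qed.

Lemma dot3E (a b : 'rV[R]_3) : dot a b =
  a 0 (inord 0) * b 0 (inord 0) + a 0 (inord 1) * b 0 (inord 1) +
  a 0 (inord 2) * b 0 (inord 2).
Proof. exact: big_ord3. Qed.

Lemma vec2E x y : (vec2 x y 0 (inord 0) = x) * (vec2 x y 0 (inord 1) = y).
Proof. by rewrite !mxE !inordK. Qed.

Lemma vec3E x y z : (vec3 x y z 0 (inord 0) = x) * (vec3 x y z 0 (inord 1) = y) *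
  (vec3 x y z 0 (inord 2) = z).
Proof. by rewrite !mxE !inordK. Qed.

Lemma unit_sphereE n (a : 'rV[R]_n) : unit_sphere R n a -> dot a a = 1.
Proof. by rewrite /unit_sphere /= => a1; rewrite -sqr_enorm a1 expr1n. Qed.

Definition unit_square_area : R := unit_area (vec3 1 0 0) (vec3 0 1 0).
Definition unit_segment_length : R :=
  fine (hausdorff_measure 1 ((fun s => s *: vec2 1 0) @` `[0%R, 1%R])).

Lemma orthonormal_vec3 : orthonormal_frame (vec3 1 0 0) (vec3 0 1 0).
Proof. by split; rewrite dot3E !vec3E; ring. Qed.

Lemma unit_square_area_gt0 : 0 < unit_square_area.
Proof.
rewrite -lte_fin -(frame_area_unitE orthonormal_vec3).
exact: frame_area_unit_gt0 orthonormal_vec3.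
Qed.

Lemma enorm_vec2_1 : enorm (vec2 1 0) = 1.
Proof. by rewrite /enorm dot2E !vec2E mulr1 mulr0 addr0 sqrtr1. Qed.

Lemma hausdorff_unit_segment_fin :
  (hausdorff_measure 1 ((fun s => s *: vec2 1 0) @` `[0%R, 1%R]) < +oo)%E.
Proof.
set w := vec2 1 0; set g := fun s : R => s *: w.
have gB s t : enorm (g s - g t) = `|s - t|.
  by rewrite /g -scalerBl enormZ enorm_vec2_1 mulr1.
apply: self_similar_hausdorff_finite.
- by exists (g 0), 0 => //=; rewrite in_itv /= lexx ler01.
- apply: (@le_lt_trans _ _ 1%:E); last exact: ltry.
  apply: ge_ereal_sup => _ [_ [s + <-]] [_ [t + <-]] <-.
  rewrite /= !in_itv /= => /andP[s0 s1] /andP[t0 t1].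
  by rewrite gB lee_fin ler_norml; lra.
move=> delta; pose half (x s : R) := g (s / 2 + x).
have halfE x : (hausdorff_content 1 (delta / 2) (half x @` `[0%R, 1%R]) <=
    (2^-1)%:E * hausdorff_content 1 delta (g @` `[0%R, 1%R]))%E.
  rewrite (mulrC delta) -[X in (X%:E * _)%E]expr1.
  apply: (@hausdorff_content_image _ _ 2 2 1 delta _ g) => // s t _ _.
  rewrite /half !gB (_ : s / 2 + x - (t / 2 + x) = 2^-1 * (s - t)); last by field.
  by rewrite normrM gtr0_norm // invr_gt0.
apply: (@le_trans _ _ (hausdorff_content 1 (delta / 2)
   (half 0 @` `[0%R, 1%R] `|` half 2^-1 @` `[0%R, 1%R]))).
  apply: le_hausdorff_content_set => _ [s + <-]; rewrite /= in_itv /= => /andP[s0 s1].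
  case: (leP s 2^-1) => h; [left; exists (2 * s)|right; exists (2 * s - 1)].
  - by rewrite /= in_itv /=; lra.
  - by rewrite /half; congr g; field.
  - by rewrite /= in_itv /=; lra.
  - by rewrite /half; congr g; field.
apply: (le_trans (hausdorff_contentU _ _ _ _)).
apply: (le_trans (leeD (halfE _) (halfE _))).
rewrite -ge0_muleDl ?lee_fin // -EFinD (_ : _ + _ = 1) ?mul1e //.
by field.
Qed.

Lemma unit_segment_length_gt0 : 0 < unit_segment_length.
Proof.
apply: fine_gt0; rewrite hausdorff_unit_segment_fin andbT.
exact: hausdorff_line_gt0 enorm_vec2_1.
Qed.

(** Solving for the first coordinate parametrises the section by the second one, which runs over all
    of [-1, 1] because [|a1| <= a0]. The section is the segment from [- w] to [w], and [w] has
    length [a0^-1]. *)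
Lemma section_volume2 (a : 'rV[R]_2) : unit_sphere R 2 a ->
  `|a 0 (inord 1)| <= a 0 (inord 0) ->
  section_volume a = 2 * unit_segment_length / a 0 (inord 0).
Proof.
move=> /unit_sphereE; rewrite dot2E; set a0 := a 0 _; set a1 := a 0 _ => a01 a10.
have a00 : 0 < a0.
  rewrite lt_neqAle (le_trans (normr_ge0 _) a10) andbT; apply/eqP => a0E.
  by move: a10 a01; rewrite -a0E normr_le0 => /eqP ->; lra.
pose w := vec2 (- a1 / a0) 1; pose g := (fun s => s *: vec2 1 0).
have ww : enorm w = a0^-1.
  rewrite /enorm dot2E !vec2E -[RHS]gtr0_norm ?invr_gt0 // -sqrtr_sqr; congr Num.sqrt.
  apply: (@mulfI _ (a0 * a0)); rewrite ?mulf_neq0 ?gt_eqF //.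
  transitivity (a0 * a0 + a1 * a1); first by field; rewrite gt_eqF.
  by rewrite a01; field; rewrite gt_eqF.
have E : cube R 2 `&` perp a = (fun s => (2 * s - 1) *: w) @` `[0%R, 1%R].
  apply/seteqP; split => x.
    rewrite /perp /= dot2E => -[cx px]; have /andP[x1 x1'] := cx (inord 1).
    exists ((x 0 (inord 1) + 1) / 2); first by rewrite /= in_itv /=; lra.
    have -> : 2 * ((x 0 (inord 1) + 1) / 2) - 1 = x 0 (inord 1) by field.
    apply/rowP; apply: ord2P; rewrite mxE vec2E ?mulr1 //.
    apply: (@mulIf _ a0); rewrite ?gt_eqF // mulrA mulfVK ?gt_eqF //.
    by move: px; rewrite -/a0 -/a1; lra.
  move=> [s + <-]; rewrite /= in_itv /= => /andP[s0 s1]; split; last first.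
    by rewrite /perp /= dotZl dot2E !vec2E -/a0 -/a1; field; rewrite gt_eqF.
  apply: ord2P; rewrite mxE vec2E; last by lra.
  rewrite -ler_norml normrM mulr_ile1 //; first by rewrite ler_norml; lra.
  by rewrite mulNr normrN normrM normfV (gtr0_norm a00) ler_pdivrMr // mul1r.
rewrite /section_volume E /unit_segment_length.
have a20 : 0 < 2 / a0 by rewrite divr_gt0.
have -> : hausdorff_measure 1 ((fun s => (2 * s - 1) *: w) @` `[0%R, 1%R]) =
    ((2 / a0)%:E * hausdorff_measure 1 (g @` `[0%R, 1%R]))%E.
  have lip s t : enorm ((2 * s - 1) *: w - (2 * t - 1) *: w) =
      2 / a0 * enorm (g s - g t).
    rewrite -!scalerBl !enormZ enorm_vec2_1 ww mulr1.
    rewrite (_ : 2 * s - 1 - (2 * t - 1) = 2 * (s - t)); last by ring.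
    by rewrite normrM ger0_norm //; ring.
  apply/eqP; rewrite eq_le; apply/andP; split.
    rewrite -[X in (X%:E * _)%E]expr1; apply: hausdorff_measure_image => // s t _ _.
    by rewrite lip.
  rewrite -lee_pdivlMl // -[X in (X%:E * _)%E]expr1.
  apply: hausdorff_measure_image; first by rewrite invr_gt0.
  by move=> s t _ _; rewrite lip mulKf ?gt_eqF.
rewrite -[hausdorff_measure 1 _]fineK; last first.
  by rewrite ge0_fin_numE ?hausdorff_measure_ge0 // hausdorff_unit_segment_fin.
by rewrite -EFinM /= mulrAC.
Qed.

End Sections.

Arguments unit_square_area : clear implicits.
Arguments unit_segment_length : clear implicits.

Section Sections3.
Context {R : realType} (a : 'rV[R]_3) (a_unit : unit_sphere R 3 a).
Let a0 := a 0 (inord 0).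
Let a1 := a 0 (inord 1).
Let a2 := a 0 (inord 2).
Context (a0_gt0 : 0 < a0).
Let u := vec3 (- a1 / a0) 1 0.
Let v := vec3 (- a2 / a0) 0 1.

Let a_sq : a0 ^+ 2 + a1 ^+ 2 + a2 ^+ 2 = 1.
Proof. by rewrite -(unit_sphereE a_unit) dot3E !expr2. Qed.

(** The plane is a graph over the last two coordinates, and [a0] is the cosine of the angle between
    its normal and the first axis; areas are stretched by [a0^-1]. *)
Let gramE : gram u v = a0^-1 ^+ 2.
Proof.
have an0 : a0 != 0 by rewrite gt_eqF.
rewrite /gram !dot3E !vec3E; apply: (@mulfI _ (a0 ^+ 2)); first by rewrite expf_neq0.
transitivity (a0 ^+ 2 + a1 ^+ 2 + a2 ^+ 2); first by field.
by rewrite a_sq; field.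
Qed.

Let gram_gt0 : 0 < gram u v.
Proof. by rewrite gramE exprn_gt0 // invr_gt0. Qed.

Let section_param : cube R 3 `&` perp a = frame_point u v @`
  [set z | [/\ `|z.1| <= 1, `|z.2| <= 1 & `|a1 * z.1 + a2 * z.2| <= a0]].
Proof.
have an0 : a0 != 0 by rewrite gt_eqF.
apply/seteqP; split => x.
  rewrite /perp /= dot3E -/a0 -/a1 -/a2 => -[cx px].
  exists (x 0 (inord 1), x 0 (inord 2)); last first.
    apply/rowP; apply: ord3P; rewrite !mxE !inordK //=; [|ring|ring].
    by apply: (@mulIf _ a0) => //; transitivity (- (x 0 (inord 1) * a1 + x 0 (inord 2) * a2));
      [field|lra].
  have cn i : `|x 0 i| <= 1 by rewrite ler_norml; exact: cx.
  split => //=.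
  have -> : a1 * x 0 (inord 1) + a2 * x 0 (inord 2) = - (a0 * x 0 (inord 0)) by lra.
  by rewrite normrN normrM (gtr0_norm a0_gt0) ger_pMr.
move=> [z [z1 z2 z0] <-]; split; last first.
  by rewrite /perp /= dot3E -/a0 -/a1 -/a2 !mxE !inordK //=; field.
apply: ord3P; rewrite !mxE !inordK //= -ler_norml.
- have -> : z.1 * (- a1 / a0) + z.2 * (- a2 / a0) = - ((a1 * z.1 + a2 * z.2) / a0) by field.
  by rewrite normrN normrM normfV (gtr0_norm a0_gt0) ler_pdivrMr // mul1r.
- by rewrite mulr1 mulr0 addr0.
- by rewrite mulr1 mulr0 add0r.
Qed.

Let unit_areaE : unit_area u v = unit_square_area R / a0.
Proof.
rewrite (unit_area_gram orthonormal_vec3) // gramE sqrtr_sqr gtr0_norm ?invr_gt0 //.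
by rewrite mulrC.
Qed.

Lemma section_volume3_parallelogram : `|a1| + `|a2| <= a0 ->
  section_volume a = 4 * unit_square_area R / a0.
Proof.
have E2 : -1 + 2 = 1 :> R by ring.
move=> a12; rewrite /section_volume section_param -/(frame_area u v _).
rewrite (_ : [set _ | _] = rect (-1) (-1 + 2) (-1) (-1 + 2)); last first.
  apply/seteqP; split => z; rewrite /rect /= !ler_norml E2.
    by move=> [z1 z2 _].
  move=> [z1 z2]; split => //; rewrite -ler_norml (le_trans (ler_normD _ _)) //.
  rewrite -!ler_norml in z1 z2; apply: le_trans a12; rewrite !normrM.
  by apply: lerD; rewrite ler_piMr.
rewrite (frame_area_square orthonormal_vec3 u v (-1) (-1) (ltr0Sn R 1)) /=.
rewrite unit_areaE mulrA; congr (_ * _ / _).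
by rewrite -natrX.
Qed.

(** Rescaling the frame by [a1^-1] and [a2^-1] turns the third constraint into [|z.1 + z.2| <= a0],
    so the section becomes the hexagon with parameters [a1], [a2], [a0]. The conditions on the
    hexagon are then the triangle inequalities. *)
Lemma section_volume3_hexagon : 0 < a1 -> 0 < a2 -> a0 < a1 + a2 ->
  a1 <= a0 + a2 -> a2 <= a0 + a1 ->
  section_volume a =
  unit_square_area R * (4 * a1 * a2 - (a1 + a2 - a0) ^+ 2) / (a0 * a1 * a2).
Proof.
move=> a1_gt0 a2_gt0 tri0 tri1 tri2.
have an : [/\ a0 != 0, a1 != 0 & a2 != 0] by rewrite !gt_eqF.
case: an => an0 an1 an2; rewrite addrC in tri1; rewrite addrC in tri2.
have gramE' : gram (a1^-1 *: u) (a2^-1 *: v) = ((a0 * a1 * a2)^-1) ^+ 2.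
  rewrite (_ : gram _ _ = a1^-1 ^+ 2 * a2^-1 ^+ 2 * gram u v); last first.
    by rewrite /gram !(dotZl, dotZr); ring.
  by rewrite gramE -!exprMn !invfM; congr (_ ^+ 2); ring.
have g0 : 0 < gram (a1^-1 *: u) (a2^-1 *: v).
  by rewrite gramE' exprn_gt0 // invr_gt0 !mulr_gt0.
rewrite /section_volume section_param -/(frame_area u v _).
rewrite -(@frame_area_scale_frame _ _ u v _
  [set z | [/\ `|z.1| <= a1, `|z.2| <= a2 & `|z.1 + z.2| <= a0]] a1^-1 a2^-1) ?invr_eq0 //;
  last first.
  move=> z /=; rewrite !invrK (mulrC a1) (mulrC a2) !normrM
    !(gtr0_norm a1_gt0, gtr0_norm a2_gt0).
  by rewrite !ger_pMl.
rewrite (hexagon_area orthonormal_vec3) //= (unit_area_gram orthonormal_vec3) // gramE'.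
rewrite sqrtr_sqr gtr0_norm ?invr_gt0 ?mulr_gt0 // /unit_square_area.
by ring.
Qed.

End Sections3.

(** * Differentials on the sphere *)

Section SphereDifferential.
Context {R : realType} {n : nat}.
Implicit Types (f g : 'rV[R]_n -> R) (a x v w : 'rV[R]_n) (L : {scalar 'rV[R]_n}).

Lemma has_sphere_differentialP f a L :
  has_sphere_differential f a L <->
  forall eps : R, 0 < eps -> exists2 delta : R, 0 < delta &
    forall x, unit_sphere R n x -> enorm (x - a) < delta ->
      `|f x - f a - L (x - a)| <= eps * enorm (x - a).
Proof.
have filt : Filter (within (unit_sphere R n) a^').
  by apply: within_filter; apply: within_filter; exact: nbhs_filter.
split=> [H eps eps0|H].
  have near_H : nbhs a [set x | x != a -> unit_sphere R n x ->
      `|(f x - f a - L (x - a)) / enorm (x - a)| < eps] :=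
    @cvgr0_norm_lt _ _ _ _ filt _ H _ eps0.
  have [d /= d0 near_a] := (@nbhs_ballP R 'rV[R]_n a _).1 near_H.
  exists d => // x Sx xad; have [->|xa] := eqVneq x a.
    by rewrite !subrr (linear0 L) subr0 normr0 enorm0 mulr0.
  have e0 : 0 < enorm (x - a).
    rewrite lt_neqAle enorm_ge0 andbT eq_sym; apply: contra_neq xa => e0.
    apply/rowP => i; apply/eqP; rewrite -subr_eq0 -normr_le0 -e0.
    by rewrite (le_trans _ (normr_le_enorm _ i)) // !mxE.
  suff : `|(f x - f a - L (x - a)) / enorm (x - a)| < eps.
    by rewrite normrM normfV (gtr0_norm e0) ltr_pdivrMr // => /ltW.
  apply: near_a => //=; split => // i j; rewrite ord1 /ball /= distrC.
  by apply: le_lt_trans xad; have := normr_le_enorm (x - a) j; rewrite !mxE.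
apply/(@cvgr0Pnorm_le _ _ _ _ filt) => eps eps0; have [d d0 Hd] := H eps eps0.
(* Library balls are balls of the sup norm: coordinates bounded by [c] give a squared Euclidean norm
   at most [n] times [c ^+ 2], which is below [(c * n.+1%:R) ^+ 2]. *)
have c0 : 0 < d / n.+1%:R by rewrite divr_gt0 // ltr0Sn.
apply: (@nbhs_ballP R 'rV[R]_n a _).2; exists (d / n.+1%:R) => //= x [_ xa] xna Sx.
have e0 := enorm_ge0 (x - a).
have lt_d : enorm (x - a) < d.
  rewrite -[d]gtr0_norm // -sqrtr_sqr ltr_sqrt ?exprn_gt0 //.
  apply: (@le_lt_trans _ _ (\sum_(i < n) (d / n.+1%:R) ^+ 2)).
    apply: ler_sum => i _; rewrite -expr2 -real_normK ?num_real // ler_pXn2r ?nnegrE //.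
      by have := xa 0 i; rewrite /ball /= distrC !mxE => /ltW.
    exact: ltW.
  have key (c : R) : 0 < c -> c ^+ 2 *+ n < (c * n.+1%:R) ^+ 2.
    move=> c_gt0; rewrite exprMn -[_ *+ n]mulr_natr.
    rewrite ltr_pM2l ?exprn_gt0 // -natrX ltr_nat.
    by rewrite expnS expn1 (leq_trans (ltnSn n)) // leq_pmulr.
  by have := key _ c0; rewrite divfK ?pnatr_eq0 // sumr_const card_ord.
rewrite normrM normfV (ger0_norm e0).
have [->|en0] := eqVneq (enorm (x - a)) 0; first by rewrite invr0 mulr0 ltW.
by rewrite ler_pdivrMr ?Hd // lt_neqAle eq_sym en0.
Qed.

(** The great circle through [a] in direction [v], with the tangent of the half angle as parameter.
    It is rational in [t] and has velocity [2 *: v] at 0, whence the factors 2 below. *)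
Definition sphere_curve a v (t : R) : 'rV[R]_n :=
  ((1 - t ^+ 2) / (1 + t ^+ 2)) *: a + (2 * t / (1 + t ^+ 2)) *: v.

Section Curve.
Context (a v : 'rV[R]_n) (aa : dot a a = 1) (vv : dot v v = 1) (va : dot v a = 0).

Let den_gt0 (t : R) : 0 < 1 + t ^+ 2.
Proof. by have := sqr_ge0 t; lra. Qed.

Lemma sphere_curve_unit t : unit_sphere R n (sphere_curve a v t).
Proof.
rewrite /unit_sphere /= /enorm !(dotDl, dotDr, dotZl, dotZr) (dotC a v) aa vv va.
rewrite [X in Num.sqrt X](_ : _ = 1) ?sqrtr1 //; field; rewrite gt_eqF //; exact: den_gt0.
Qed.

Lemma sphere_curveB t : sphere_curve a v t - a =
  (2 * t / (1 + t ^+ 2)) *: v - (2 * t ^+ 2 / (1 + t ^+ 2)) *: a.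
Proof.
have -> : 2 * t ^+ 2 / (1 + t ^+ 2) = 1 - (1 - t ^+ 2) / (1 + t ^+ 2).
  by field; rewrite gt_eqF //; exact: den_gt0.
by rewrite scalerBl scale1r opprB /sphere_curve addrAC [RHS]addrC.
Qed.

Lemma enorm_sphere_curveB t : enorm (sphere_curve a v t - a) <= 2 * `|t|.
Proof.
rewrite -(@ler_pXn2r _ 2) ?nnegrE ?enorm_ge0 ?mulr_ge0 //.
rewrite sqr_enorm sphere_curveB -scaleNr.
rewrite !(dotDl, dotDr, dotZl, dotZr) (dotC a v) aa vv va [leRHS]exprMn real_normK ?num_real //.
rewrite [leLHS](_ : _ = 4 * t ^+ 2 / (1 + t ^+ 2)); last first.
  by field; rewrite gt_eqF //; exact: den_gt0.
rewrite ler_pdivrMr ?den_gt0 // -natrX; have := sqr_ge0 t; nra.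
Qed.

Lemma differential_along_curve f L : has_sphere_differential f a L ->
  forall eps : R, 0 < eps -> exists2 delta : R, 0 < delta &
    forall t, `|t| < delta ->
      `|f (sphere_curve a v t) - f a - 2 * t * L v| <= eps * `|t|.
Proof.
move=> /has_sphere_differentialP H eps eps0.
have e4 : 0 < eps / 4 by rewrite divr_gt0.
(* Half of [eps] pays for the remainder of [f], since the chord is at most [2 * |t|]. The other half
   pays for [r], the gap between tangent and chord under [L]; it is quadratic in [t], with [M]
   bounding its coefficient. *)
have [d d0 Hd] := H _ e4; set M := `|L a| + `|L v| + 1.
have M0 : 0 < M by rewrite ltr_wpDl // addr_ge0.
exists (Num.min (Num.min 1 (d / 2)) (eps / (4 * M))).
  by rewrite !lt_min ltr01 !divr_gt0 // mulr_gt0.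
move=> t; rewrite !lt_min => /andP[/andP[t1 td] teps].
have cd : enorm (sphere_curve a v t - a) < d.
  by apply: le_lt_trans (enorm_sphere_curveB t) _; rewrite mulrC -ltr_pdivlMr.
pose D := 1 + t ^+ 2; pose F := f (sphere_curve a v t) - f a.
have LD : L (sphere_curve a v t - a) = 2 * t / D * L v - 2 * t ^+ 2 / D * L a.
  by rewrite sphere_curveB (linearB L) !(linearZ_LR L).
have := Hd _ (sphere_curve_unit t) cd; rewrite LD -/F => h1.
have D0 : 0 < D by exact: den_gt0.
have D1 : 1 <= D by rewrite lerDl sqr_ge0.
pose r := 2 * t * L v - (2 * t / D * L v - 2 * t ^+ 2 / D * L a).
have rE : r = 2 * t * t * ((t * L v + L a) / D).
  by rewrite /r /D; field; rewrite gt_eqF.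
have r_le : `|r| <= eps / 2 * `|t|.
  rewrite rE !normrM normfV (gtr0_norm D0) (ger0_norm (ler0n _ 2)).
  have h2 : `|t * L v + L a| / D <= M.
    rewrite ler_pdivrMr //; apply: le_trans (_ : M <= _); last by rewrite ler_peMr // ltW.
    apply: le_trans (ler_normD _ _) _; rewrite normrM /M.
    have := ler_piMl (normr_ge0 (L v)) (ltW t1); lra.
  have h3 : `|t| * M <= eps / 4.
    move: teps; rewrite ltr_pdivlMr ?mulr_gt0 // => /ltW; lra.
  have h4 : `|t| * (`|t * L v + L a| / D) <= eps / 4.
    by apply: le_trans h3; rewrite ler_wpM2l.
  have := ler_wpM2l (normr_ge0 t) h4; lra.
rewrite -/F.
have -> : F - 2 * t * L v = F - (2 * t / D * L v - 2 * t ^+ 2 / D * L a) - r.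
  by rewrite /r; ring.
apply: le_trans (ler_normB _ _) _.
have := ler_wpM2l (ltW e4) (enorm_sphere_curveB t); lra.
Qed.

(** Lets criticality be tested on any one known differential, although its definition only provides
    some linear form. *)
Lemma differential_unique f L L' : has_sphere_differential f a L ->
  has_sphere_differential f a L' -> L v = L' v.
Proof.
move=> H H'; apply/eqP; rewrite -subr_eq0 -normr_eq0; apply/negPn/negP => neq.
have e0 : 0 < `|L v - L' v| by rewrite lt_neqAle eq_sym neq normr_ge0.
have e2 : 0 < `|L v - L' v| / 2 by rewrite divr_gt0.
have [d d0 Hd] := differential_along_curve H e2.
have [d' d'0 Hd'] := differential_along_curve H' e2.
pose t := Num.min d d' / 2.
have m0 : 0 < Num.min d d' by rewrite lt_min d0.
have t0 : 0 < t by rewrite divr_gt0.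
have td : `|t| < Num.min d d' by rewrite gtr0_norm // /t; lra.
move: td; rewrite lt_min => /andP[/Hd h /Hd' h'].
have : `|2 * t * L v - 2 * t * L' v| <= `|L v - L' v| * t.
  set F := f _ - f a in h h'.
  have -> : 2 * t * L v - 2 * t * L' v = (F - 2 * t * L' v) - (F - 2 * t * L v) by ring.
  apply: le_trans (ler_normB _ _) _; move: h h'; rewrite (gtr0_norm t0); lra.
rewrite -mulrBr normrM gtr0_norm ?mulr_gt0 //.
have := mulr_gt0 t0 e0; lra.
Qed.

(* A function that is even along a curve through [a] and decreases at least
   linearly on both sides of [a] has a kink there. *)
Lemma kink_not_differentiable f (kappa delta : R) : 0 < kappa -> 0 < delta ->
  (forall t, 0 < t -> t < delta ->
     f (sphere_curve a v (- t)) = f (sphere_curve a v t) /\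
     f (sphere_curve a v t) <= f a - kappa * t) ->
  ~ sphere_differentiable f a.
Proof.
move=> k0 d0 Hf [L H].
have k2 : 0 < kappa / 2 by rewrite divr_gt0.
have [d d'0 Hd] := differential_along_curve H k2.
pose t := Num.min delta d / 2.
have m0 : 0 < Num.min delta d by rewrite lt_min d0.
have t0 : 0 < t by rewrite divr_gt0.
have : t < Num.min delta d by rewrite /t; lra.
rewrite lt_min => /andP[td td'].
have [even dec] := Hf t t0 td.
have /Hd h : `|t| < d by rewrite gtr0_norm.
have /Hd : `|- t| < d by rewrite normrN gtr0_norm.
(* The values at [t] and [- t] agree and the linear terms are opposite. Adding the two estimates
   bounds the decrease by [kappa / 2 * t]. *)
rewrite even => h'; move: h h'; rewrite normrN (gtr0_norm t0) !ler_norml.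
move=> /andP[h1 h2] /andP[h3 h4].
have := mulr_gt0 k0 t0; lra.
Qed.

End Curve.
End SphereDifferential.

(** * Expansions with quadratic remainder *)

Definition dot_form (R : realType) n (w : 'rV[R]_n) : 'rV[R]_n -> R := fun x => dot w x.

Lemma dot_form_linear (R : realType) n (w : 'rV[R]_n) : linear_for *%R (dot_form w).
Proof. by move=> k x y; rewrite /dot_form dotDr dotZr. Qed.

HB.instance Definition _ (R : realType) n (w : 'rV[R]_n) :=
  GRing.isLinear.Build R 'rV[R]_n R *%R (dot_form w) (dot_form_linear w).

(** A quadratic remainder, rather than little-o, makes sums and products explicit and absorbs any
    perturbation that is quadratic on the sphere near [a]. The ambient vector [w] plays the part of
    a gradient. *)
Definition second_order (R : realType) n (f : 'rV[R]_n -> R) (a w : 'rV[R]_n) :=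
  exists2 C, 0 <= C & exists2 d, 0 < d & forall x, unit_sphere R n x ->
    enorm (x - a) < d -> `|f x - f a - dot w (x - a)| <= C * enorm (x - a) ^+ 2.

Section SecondOrder.
Context {R : realType} {n : nat}.
Implicit Types (f g : 'rV[R]_n -> R) (a x v w : 'rV[R]_n).

Lemma dot_le_enorm w x : `|dot w x| <= (\sum_(i < n) `|w 0 i|) * enorm x.
Proof.
rewrite (le_trans (ler_norm_sum _ _ _)) // mulr_suml; apply: ler_sum => i _.
by rewrite normrM ler_wpM2l // normr_le_enorm.
Qed.

Lemma second_order_differential f a w : second_order f a w ->
  has_sphere_differential f a (dot_form w : {scalar 'rV[R]_n}).
Proof.
move=> [C C0 [d d0 Hd]]; apply/has_sphere_differentialP => eps eps0.
exists (Num.min d (eps / (C + 1))); first by rewrite lt_min d0 divr_gt0 // ltr_wpDl.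
move=> x Sx; rewrite lt_min => /andP[xd]; rewrite ltr_pdivlMr ?ltr_wpDl // => xe.
apply: (le_trans (Hd x Sx xd)); rewrite expr2 mulrA ler_wpM2r ?enorm_ge0 //.
have := enorm_ge0 (x - a); lra.
Qed.

(** The expansion rules out the non-differentiable alternative, and uniqueness on normalised tangent
    vectors carries the vanishing of [L] over to [w]. *)
Lemma second_order_critical f a w : dot a a = 1 -> second_order f a w ->
  (sphere_critical_point f a <-> forall v, dot v a = 0 -> dot w v = 0).
Proof.
move=> aa /second_order_differential H; split; last first.
  by move=> wv; left; exists (dot_form w : {scalar 'rV[R]_n}).
case=> [[L HL L0] v va|]; last by case; exists (dot_form w : {scalar 'rV[R]_n}).
have [v0|vn0] := eqVneq (dot v v) 0.
  have -> : v = 0.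
    apply/rowP => i; apply/eqP; rewrite mxE -normr_le0.
    by rewrite (le_trans (normr_le_enorm _ _)) // /enorm v0 sqrtr0.
  by rewrite -(scale0r (0 : 'rV[R]_n)) dotZr mul0r.
have e0 : 0 < enorm v by rewrite sqrtr_gt0 lt_neqAle eq_sym vn0 dot_ge0.
have en0 : enorm v != 0 by rewrite gt_eqF.
have u1 : dot ((enorm v)^-1 *: v) ((enorm v)^-1 *: v) = 1.
  by rewrite dotZl dotZr -sqr_enorm; field.
have ua : dot ((enorm v)^-1 *: v) a = 0 by rewrite dotZl va mulr0.
have := differential_unique aa u1 ua H HL.
rewrite (L0 _ ua) /= /dot_form dotZr => /eqP; rewrite mulf_eq0 invr_eq0 (negbTE en0).
by move=> /eqP.
Qed.

Lemma second_order_cst (c : R) a : second_order (fun=> c) a 0.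
Proof.
exists 0 => //; exists 1 => // x _ _.
by rewrite -(scale0r (0 : 'rV[R]_n)) dotZl mul0r !subrr normr0 mul0r.
Qed.

Lemma second_orderD f g a w w' : second_order f a w -> second_order g a w' ->
  second_order (fun x => f x + g x) a (w + w').
Proof.
move=> [C C0 [d d0 H]] [C' C'0 [d' d'0 H']]; exists (C + C'); first exact: addr_ge0.
exists (Num.min d d'); first by rewrite lt_min d0.
move=> x Sx; rewrite lt_min => /andP[/(H x Sx) h /(H' x Sx) h'].
rewrite dotDl (_ : _ - _ - _ =
  (f x - f a - dot w (x - a)) + (g x - g a - dot w' (x - a))); last by ring.
by rewrite (le_trans (ler_normD _ _)) // mulrDl lerD.
Qed.

Lemma second_orderM f g a w w' : second_order f a w -> second_order g a w' ->
  second_order (fun x => f x * g x) a (g a *: w + f a *: w').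
Proof.
move=> [C C0 [d d0 H]] [C' C'0 [d' d'0 H']].
pose W := \sum_(i < n) `|w 0 i|; pose W' := \sum_(i < n) `|w' 0 i|.
have W0 : 0 <= W by exact: sumr_ge0.
have W'0 : 0 <= W' by exact: sumr_ge0.
pose G := `|g a| + W' + C'.
exists (C * G + `|f a| * C' + W * (W' + C')).
  by rewrite !(addr_ge0, mulr_ge0).
exists (Num.min (Num.min d d') 1); first by rewrite !lt_min d0 d'0 ltr01.
move=> x Sx; rewrite !lt_min => /andP[/andP[/(H x Sx) h /(H' x Sx) h'] e1].
set e := enorm (x - a) in h h' e1 *; have e0 : 0 <= e by exact: enorm_ge0.
have wx := dot_le_enorm w (x - a); have wx' := dot_le_enorm w' (x - a).
rewrite -/W -/e in wx; rewrite -/W' -/e in wx'.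
rewrite dotDl !dotZl.
set p := dot w _ in h wx *; set p' := dot w' _ in h' wx' *.
have e2 : e ^+ 2 <= e by rewrite expr2 ler_piMr // ltW.
have gd : `|g x - g a| <= (W' + C') * e.
  rewrite -[g x - g a](subrK p') (le_trans (ler_normD _ _)) //.
  by rewrite mulrDl [leRHS]addrC lerD // (le_trans h') // ler_wpM2l.
have gG : `|g x| <= G.
  rewrite -[g x](subrK (g a)) (le_trans (ler_normD _ _)) // /G -addrA [leRHS]addrC lerD //.
  by rewrite (le_trans gd) // ler_piMr ?addr_ge0 // ltW.
(* The three terms give the three summands of the constant: [G] bounds [g] at distance at most 1,
   and the last term is a product of two first-order quantities. *)
rewrite (_ : _ - _ - _ = (f x - f a - p) * g x + f a * (g x - g a - p') + p * (g x - g a));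
  last by ring.
apply: le_trans (ler_normD _ _) _; rewrite [leRHS]mulrDl; apply: lerD.
  apply: le_trans (ler_normD _ _) _; rewrite [leRHS]mulrDl; apply: lerD; rewrite normrM.
    by rewrite mulrAC ler_pM.
  by rewrite -mulrA ler_wpM2l.
rewrite normrM; apply: le_trans (ler_pM _ _ wx gd) _ => //.
by rewrite expr2 mulrACA.
Qed.

Lemma second_order_near f g a w (C d : R) : 0 <= C -> 0 < d -> second_order g a w ->
  f a = g a ->
  (forall x, unit_sphere R n x -> enorm (x - a) < d ->
     `|f x - g x| <= C * enorm (x - a) ^+ 2) -> second_order f a w.
Proof.
move=> C0 d0 [C' C'0 [d' d'0 H]] fga Hfg; exists (C + C'); first exact: addr_ge0.
exists (Num.min d d'); first by rewrite lt_min d0.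
move=> x Sx; rewrite lt_min => /andP[/(Hfg x Sx) h /(H x Sx) h'].
rewrite fga (_ : _ - _ - _ = (f x - g x) + (g x - g a - dot w (x - a))); last by ring.
by rewrite (le_trans (ler_normD _ _)) // mulrDl lerD.
Qed.

Lemma second_orderZ f a w (k : R) : second_order f a w ->
  second_order (fun x => k * f x) a (k *: w).
Proof.
move=> H; have := second_orderM (second_order_cst k a) H.
by rewrite scaler0 add0r.
Qed.

Lemma dot_delta (i : 'I_n) x : dot (delta_mx 0 i) x = x 0 i.
Proof.
rewrite /dot (bigD1 i) //= big1 ?addr0; first by rewrite mxE !eqxx mul1r.
by move=> j ji; rewrite mxE eqxx (negbTE ji) mul0r.
Qed.

(** With [b] and [y] the coordinates of [a] and [x], the remainder is exactly
    [(y - b) ^+ 2 / (b ^+ 2 * y)], and [y >= b / 2] near [a]. *)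
Lemma second_order_inv_coord a (i : 'I_n) : 0 < a 0 i ->
  second_order (fun x => (x 0 i)^-1) a (- ((a 0 i)^-1 ^+ 2) *: delta_mx 0 i).
Proof.
move=> a0; exists (2 * (a 0 i)^-1 ^+ 3).
  by rewrite mulr_ge0 // exprn_ge0 // invr_ge0 ltW.
exists (a 0 i / 2); first by rewrite divr_gt0.
move=> x _ xd; rewrite dotZl dot_delta !mxE.
have xi := normr_le_enorm (x - a) i; rewrite !mxE in xi.
have := le_lt_trans xi xd; rewrite ltr_norml => /andP[x1 x2].
have x0 : a 0 i / 2 <= x 0 i by lra.
have x00 : 0 < x 0 i by lra.
set y := x 0 i in xi x1 x2 x0 x00 *; set b := a 0 i in a0 x1 x2 x0 xi *.
rewrite (_ : _ - _ - _ = (y - b) ^+ 2 * (b^-1 ^+ 2 * y^-1)); last first.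
  by field; rewrite !gt_eqF.
rewrite normrM ger0_norm ?sqr_ge0 // mulrC.
have b0 : 0 <= b^-1 ^+ 2 by rewrite exprn_ge0 // invr_ge0 ltW.
have yb : y^-1 <= 2 * b^-1.
  by rewrite -[2]invrK -invfM lef_pV2 ?posrE ?mulr_gt0 ?invr_gt0 // mulrC.
rewrite ler_pM ?sqr_ge0 //.
  rewrite ger0_norm ?mulr_ge0 ?invr_ge0 ?(ltW x00) ?(ltW a0) //.
  have -> : 2 * b^-1 ^+ 3 = b^-1 ^+ 2 * (2 * b^-1) by ring.
  by rewrite ler_wpM2l.
by rewrite -real_normK ?num_real // ler_pXn2r ?nnegrE ?enorm_ge0.
Qed.

End SecondOrder.

(** * Critical directions *)

Lemma signed_perm_linear (R : realType) n (s : 'S_n) (e : 'I_n -> bool) :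
  linear (@signed_perm R n s e).
Proof. by move=> k x y; apply/rowP => i; rewrite !mxE mulrDr mulrCA. Qed.

HB.instance Definition _ (R : realType) n (s : 'S_n) (e : 'I_n -> bool) :=
  GRing.isLinear.Build R 'rV[R]_n 'rV[R]_n *:%R (@signed_perm R n s e)
    (@signed_perm_linear R n s e).

Section Transport.
Context {R : realType} {n : nat}.
Implicit Types (s : 'S_n) (e : 'I_n -> bool) (a b x : 'rV[R]_n) (L : {scalar 'rV[R]_n}).

Lemma unit_sphere_signed_perm s e x :
  unit_sphere R n (signed_perm s e x) <-> unit_sphere R n x.
Proof. by rewrite /unit_sphere /= enorm_signed_perm. Qed.

Lemma has_sphere_differential_signed_perm s e b L :
  has_sphere_differential (@section_volume R n) b L ->
  has_sphere_differential (@section_volume R n) (signed_perm s e b)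
    (L \o signed_perm s^-1%g (e \o (s^-1)%g) : {scalar 'rV[R]_n}).
Proof.
move=> /has_sphere_differentialP H; apply/has_sphere_differentialP => eps eps0.
have [d d0 Hd] := H eps eps0; exists d => // x; rewrite -(signed_permVK s e x).
set y := signed_perm s^-1%g _ x; move=> /unit_sphere_signed_perm Sy.
rewrite -signed_permB enorm_signed_perm => /(Hd y Sy).
by rewrite !section_volume_signed_perm /= signed_permK.
Qed.

Lemma critical_signed_perm s e b :
  sphere_critical_point (@section_volume R n) b ->
  sphere_critical_point (@section_volume R n) (signed_perm s e b).
Proof.
case=> [[L H L0]|ndiff].
  left; exists (L \o signed_perm s^-1%g (e \o (s^-1)%g) : {scalar 'rV[R]_n}).
    exact: has_sphere_differential_signed_perm.
  move=> v pv /=; apply: L0; rewrite /perp /=.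
  by rewrite -(dot_signed_perm s e) signed_permVK.
right=> -[L /(@has_sphere_differential_signed_perm s^-1%g (e \o (s^-1)%g))].
rewrite signed_permK => H; apply: ndiff; eexists; exact: H.
Qed.

Lemma exists_sorting_signed_perm a : exists s e,
  (forall i, 0 <= signed_perm s e a 0 i) /\
  (forall i j : 'I_n, (i <= j)%N -> signed_perm s e a 0 j <= signed_perm s e a 0 i).
Proof.
pose t := [tuple `|a 0 i| | i < n].
pose geR : rel R := fun p q => q <= p.
have geR_trans : transitive geR by move=> x y z xy yz; exact: le_trans yz xy.
have geR_total : total geR by move=> x y; rewrite /geR le_total.
have /tuple_permP [s sE] : perm_eq (sort geR t) t by rewrite perm_sort.
pose e i := a 0 (s i) < 0.
have absE i : signed_perm s e a 0 i = `|a 0 (s i)|.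
  rewrite mxE /e; case: ltP => h; first by rewrite expr1 mulN1r ltr0_norm.
  by rewrite expr0 mul1r ger0_norm.
exists s, e; split=> [i|i j ij]; first by rewrite absE.
rewrite !absE.
have nthE (k : 'I_n) : nth 0 (sort geR t) k = `|a 0 (s k)|.
  by rewrite sE (nth_map k) ?size_enum_ord // nth_ord_enum tnth_mktuple.
rewrite -!nthE; apply: (sorted_leq_nth geR_trans _ 0 (sort_sorted geR_total t)) => //.
- by move=> x; rewrite /geR.
- by rewrite inE size_sort size_tuple.
- by rewrite inE size_sort size_tuple.
Qed.

(** The gradient is a nonzero multiple of a coordinate vector, which is normal to the sphere only at
    that vector and its opposite. The quadratic tolerance admits points where two volume formulas
    meet to first order. *)
Lemma critical_inverse_coord (f : 'rV[R]_n -> R) a (i : 'I_n) (K C d : R) :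
  dot a a = 1 -> 0 < K -> 0 < a 0 i -> 0 <= C -> 0 < d ->
  (forall x, unit_sphere R n x -> enorm (x - a) < d ->
     `|f x - K / x 0 i| <= C * enorm (x - a) ^+ 2) ->
  (sphere_critical_point f a <-> a = delta_mx 0 i).
Proof.
move=> aa K0 a0 C0 d0 near_f.
have fa : f a = K / a 0 i.
  have Sa : unit_sphere R n a by rewrite /unit_sphere /= /enorm aa sqrtr1.
  have := near_f a Sa; rewrite subrr enorm0 expr0n mulr0 => /(_ d0).
  by rewrite normr_le0 subr_eq0 => /eqP.
have H := second_order_near C0 d0 (second_orderZ K (second_order_inv_coord a0)) fa near_f.
apply: iff_trans (second_order_critical aa H) _.
have k0 : - K * (a 0 i)^-1 ^+ 2 != 0.
  by rewrite mulf_neq0 ?oppr_eq0 ?expf_neq0 ?invr_eq0 ?gt_eqF.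
have wE v : dot (K *: (- ((a 0 i)^-1 ^+ 2) *: delta_mx 0 i)) v =
    - K * (a 0 i)^-1 ^+ 2 * v 0 i.
  by rewrite !dotZl dot_delta; ring.
split=> [Hv|aE v va]; last first.
  by rewrite wE -(dot_delta i v) -aE (dotC a v) va mulr0.
(* The test vector is the tangential part of the coordinate vector; its own [i]-th coordinate is
   [1 - a 0 i ^+ 2]. *)
have /Hv : dot (delta_mx 0 i - a 0 i *: a) a = 0.
  by rewrite -scaleNr dotDl dotZl aa dot_delta mulr1 subrr.
rewrite wE => /eqP; rewrite mulf_eq0 (negbTE k0) /= !mxE !eqxx /= subr_eq0 => /eqP ai2.
have ai : a 0 i = 1 by apply/eqP; rewrite -(@eqrXn2 _ 2) ?ltW // expr1n expr2 -ai2.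
have rest : \sum_(j < n | j != i) a 0 j ^+ 2 = 0.
  under eq_bigr do rewrite expr2.
  by move: aa; rewrite /dot (bigD1 i) //= ai mulr1; set S := \sum_(_ < _ | _) _; lra.
apply/rowP => j; rewrite mxE eqxx /=; have [->|ji] := eqVneq j i; first by [].
have := psumr_eq0P (fun j _ => sqr_ge0 (a 0 j)) rest ji.
by move=> /eqP; rewrite sqrf_eq0 => /eqP.
Qed.

End Transport.

(** * Sorted directions, regime by regime *)

Section Cases.
Context {R : realType}.

Lemma coord_dist n (x a : 'rV[R]_n) i : `|x 0 i - a 0 i| <= enorm (x - a).
Proof. by have := normr_le_enorm (x - a) i; rewrite !mxE. Qed.

Section Dim2.
Context (a : 'rV[R]_2) (a_unit : unit_sphere R 2 a).
Let a0 : R := a 0 (inord 0).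
Let a1 : R := a 0 (inord 1).
Context (a1_ge0 : 0 <= a1) (a10 : a1 <= a0).

Let a_sq : a0 ^+ 2 + a1 ^+ 2 = 1.
Proof. by rewrite -(unit_sphereE a_unit) dot2E !expr2. Qed.

Let a0_gt0 : 0 < a0.
Proof.
rewrite lt_neqAle (le_trans a1_ge0 a10) andbT; apply/eqP => a0E.
have a1E : a1 = 0 by apply/eqP; rewrite eq_le a1_ge0 {1}a0E a10.
by move: a_sq; rewrite -a0E a1E expr2 mul0r; lra.
Qed.

Lemma critical2_dominant : a1 < a0 ->
  sphere_critical_point (@section_volume R 2) a <-> a = delta_mx 0 (inord 0).
Proof.
have [s_a1 s_a10 s_a0] : [/\ 0 <= a1, a1 <= a0 & 0 < a0] by [].
(* Within half the gap the first coordinate remains dominant, so the volume formula persists. *)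
move=> lt10; have d0 : 0 < (a0 - a1) / 2 by lra.
have K0 : 0 < 2 * unit_segment_length R by rewrite mulr_gt0 // unit_segment_length_gt0.
apply: (critical_inverse_coord (unit_sphereE a_unit) K0 a0_gt0 (lexx 0) d0) => x Sx.
have := coord_dist x a (inord 0); have := coord_dist x a (inord 1).
rewrite -/a0 -/a1; set e := enorm _.
move=> /ler_normlP[h1 h2] /ler_normlP[h3 h4] ed.
have le10 : `|x 0 (inord 1)| <= x 0 (inord 0) by rewrite ler_norml; lra.
by rewrite section_volume2 // subrr normr0 mul0r.
Qed.

Lemma critical2_diagonal : a1 = a0 -> sphere_critical_point (@section_volume R 2) a.
Proof.
have [s_a1 s_a10 s_a0] : [/\ 0 <= a1, a1 <= a0 & 0 < a0] by [].
move=> a1E; right; set K := 2 * unit_segment_length R.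
have K0 : 0 < K by rewrite mulr_gt0 // unit_segment_length_gt0.
have h2 : 2 * a0 ^+ 2 = 1 by move: a_sq; rewrite a1E; lra.
(* Along this circle the two coordinates are exchanged when [t] changes sign, which gives
   evenness. *)
pose v := vec2 a0 (- a0).
have vv : dot v v = 1 by rewrite dot2E !vec2E; lra.
have va : dot v a = 0 by rewrite dot2E !vec2E -/a0 -/a1 a1E; ring.
have kappa0 : 0 < K / a0 / 2 by rewrite !divr_gt0.
have aa := unit_sphereE a_unit.
have fa : section_volume a = K / a0.
  by rewrite section_volume2 // -/a1 ger0_norm.
have cE t : (sphere_curve a v t 0 (inord 0) = (1 + 2 * t - t ^+ 2) * a0 / (1 + t ^+ 2)) *
            (sphere_curve a v t 0 (inord 1) = (1 - 2 * t - t ^+ 2) * a0 / (1 + t ^+ 2)).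
  by rewrite !mxE !inordK //= -/a0 -/a1 a1E; split; ring.
(* The one-sided slope of the volume at 0 is [- 2 * K / a0]; a quarter of it leaves room for the
   higher-order terms. *)
apply: (@kink_not_differentiable _ _ a v aa vv va _ (K / a0 / 2) (1 / 4)) => // t t0 t4.
have D0 : 0 < 1 + t ^+ 2 by have := sqr_ge0 t; lra.
have tt : t ^+ 2 <= t / 4 by rewrite expr2 mulrC ler_wpM2l ?(ltW t0) //; lra.
have t2 : 0 < t ^+ 2 by rewrite exprn_gt0.
have N0 : 0 < 1 + 2 * t - t ^+ 2 by lra.
have ft : section_volume (sphere_curve a v t) =
    K / a0 * ((1 + t ^+ 2) / (1 + 2 * t - t ^+ 2)).
  have dom : `|sphere_curve a v t 0 (inord 1)| <= sphere_curve a v t 0 (inord 0).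
    rewrite !cE !normrM normfV (gtr0_norm D0) (gtr0_norm a0_gt0).
    by rewrite ler_pM2r ?invr_gt0 // ler_pM2r // ler_norml; lra.
  rewrite section_volume2 //; last exact: sphere_curve_unit.
  by rewrite cE -/K; field; rewrite !gt_eqF.
split.
  pose s := tperm (inord 0 : 'I_2) (inord 1).
  have -> : sphere_curve a v (- t) = signed_perm s (fun=> false) (sphere_curve a v t).
    apply/rowP; apply: ord2P; rewrite [RHS]mxE expr0 mul1r.
      by rewrite tpermL !cE sqrrN; ring.
    by rewrite tpermR !cE sqrrN; ring.
  by rewrite section_volume_signed_perm.
rewrite ft fa (_ : K / a0 - K / a0 / 2 * t = K / a0 * (1 - t / 2)); last by ring.
apply: ler_wpM2l; first by rewrite ltW // divr_gt0.
rewrite ler_pdivrMr //.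
have t3 : 0 <= t ^+ 2 * t by rewrite mulr_ge0 // ltW.
rewrite (_ : (1 - t / 2) * (1 + 2 * t - t ^+ 2) =
  1 + 3 / 2 * t - 2 * t ^+ 2 + t ^+ 2 * t / 2); last by field.
lra.
Qed.

End Dim2.

Section Dim3.
Context (a : 'rV[R]_3) (a_unit : unit_sphere R 3 a).
Let a0 : R := a 0 (inord 0).
Let a1 : R := a 0 (inord 1).
Let a2 : R := a 0 (inord 2).
Context (a2_ge0 : 0 <= a2) (a21 : a2 <= a1) (a10 : a1 <= a0).
Let kappa := unit_square_area R.

Let kappa_gt0 : 0 < kappa. Proof. exact: unit_square_area_gt0. Qed.

Let a_sq : a0 ^+ 2 + a1 ^+ 2 + a2 ^+ 2 = 1.
Proof. by rewrite -(unit_sphereE a_unit) dot3E !expr2. Qed.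

Let a0_gt0 : 0 < a0.
Proof.
rewrite lt_neqAle (le_trans a2_ge0 (le_trans a21 a10)) andbT; apply/eqP => a0E.
have a1E : a1 = 0 by apply/eqP; rewrite eq_le (le_trans a2_ge0 a21) {1}a0E a10.
have a2E : a2 = 0 by apply/eqP; rewrite eq_le a2_ge0 -a1E a21.
by move: a_sq; rewrite -a0E a1E a2E expr2 mul0r; lra.
Qed.

Lemma critical3_dominant : a1 + a2 < a0 ->
  sphere_critical_point (@section_volume R 3) a <-> a = delta_mx 0 (inord 0).
Proof.
have [s_a2 s_a21 s_a10 s_a0] : [/\ 0 <= a2, a2 <= a1, a1 <= a0 & 0 < a0] by [].
move=> lt120; have d0 : 0 < (a0 - a1 - a2) / 4 by lra.
have K0 : 0 < 4 * kappa by rewrite mulr_gt0.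
apply: (critical_inverse_coord (unit_sphereE a_unit) K0 a0_gt0 (lexx 0) d0) => x Sx.
have := coord_dist x a (inord 0); have := coord_dist x a (inord 1).
have := coord_dist x a (inord 2).
rewrite -/a0 -/a1 -/a2; set e := enorm _.
move=> /ler_normlP[h1 h2] /ler_normlP[h3 h4] /ler_normlP[h5 h6] ed.
have n1 : `|x 0 (inord 1)| <= a1 + (a0 - a1 - a2) / 4 by rewrite ler_norml; lra.
have n2 : `|x 0 (inord 2)| <= a2 + (a0 - a1 - a2) / 4 by rewrite ler_norml; lra.
have x00 : 0 < x 0 (inord 0) by lra.
have le120 : `|x 0 (inord 1)| + `|x 0 (inord 2)| <= x 0 (inord 0) by lra.
by rewrite section_volume3_parallelogram // subrr normr0 mul0r.
Qed.

(* On this stratum the hexagon formula differs from the parallelogram formula by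
   a square, so the volume is still differentiable. *)
Lemma critical3_transition : a1 + a2 = a0 -> 0 < a2 ->
  sphere_critical_point (@section_volume R 3) a <-> a = delta_mx 0 (inord 0).
Proof.
have [s_a2 s_a21 s_a10 s_a0] : [/\ 0 <= a2, a2 <= a1, a1 <= a0 & 0 < a0] by [].
move=> eq120 a2_gt0; have d0 : 0 < a2 / 4 by lra.
have K0 : 0 < 4 * kappa by rewrite mulr_gt0.
(* A lower bound for all three coordinates near [a]. The factor 9 in the constant below is the
   square of 3: [x1 + x2 - x0] vanishes at [a], so it is at most three times the distance. *)
pose m := a2 / 2; have m0 : 0 < m by rewrite /m; lra.
have C0 : 0 <= 9 * kappa / (m * m * m) by rewrite ltW // divr_gt0 ?mulr_gt0.
apply: (critical_inverse_coord (unit_sphereE a_unit) K0 a0_gt0 C0 d0) => x Sx.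
have := coord_dist x a (inord 0); have := coord_dist x a (inord 1).
have := coord_dist x a (inord 2).
rewrite -/a0 -/a1 -/a2; set x0 := x 0 (inord 0); set x1 := x 0 (inord 1).
set x2 := x 0 (inord 2); set e := enorm _.
move=> /ler_normlP[h1 h2] /ler_normlP[h3 h4] /ler_normlP[h5 h6] ed.
have [x0m x1m x2m] : [/\ m <= x0, m <= x1 & m <= x2] by rewrite /m; split; lra.
have [x0p x1p x2p] : [/\ 0 < x0, 0 < x1 & 0 < x2] by split; lra.
have [le120|lt012] := leP (x1 + x2) x0.
  rewrite section_volume3_parallelogram //; last by rewrite !gtr0_norm.
  by rewrite subrr normr0 mulr_ge0 ?sqr_ge0.
rewrite section_volume3_hexagon //; try (rewrite -/x0 -/x1 -/x2; lra).
rewrite -/x0 -/x1 -/x2 -/kappa.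
rewrite (_ : _ - _ = - (kappa * (x1 + x2 - x0) ^+ 2 / (x0 * x1 * x2))); last first.
  by field; rewrite !gt_eqF.
have P0 : 0 < x0 * x1 * x2 by rewrite !mulr_gt0.
have r0 : 0 <= kappa * (x1 + x2 - x0) ^+ 2 / (x0 * x1 * x2).
  by apply: divr_ge0; [apply: mulr_ge0; [exact: ltW|exact: sqr_ge0]|exact: ltW].
rewrite normrN (ger0_norm r0).
have sq : (x1 + x2 - x0) ^+ 2 <= 9 * e ^+ 2.
  by rewrite (_ : 9 * e ^+ 2 = (3 * e) ^+ 2) ?ler_pXn2r ?nnegrE //; [lra|lra|lra|ring].
have m_ge0 := ltW m0.
have prod : m * m * m <= x0 * x1 * x2.
  by apply: ler_pM => //; [exact: mulr_ge0|exact: ler_pM].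
rewrite ler_pdivrMr //.
apply: (@le_trans _ _ (kappa * (9 * e ^+ 2))); first by rewrite ler_wpM2l // ltW.
rewrite (_ : 9 * kappa / (m * m * m) * e ^+ 2 * (x0 * x1 * x2) =
  kappa * (9 * e ^+ 2) * ((x0 * x1 * x2) / (m * m * m))); last by ring.
apply: ler_peMr.
  by apply: mulr_ge0; [exact: ltW|apply: mulr_ge0 => //; exact: sqr_ge0].
by rewrite ler_pdivlMr ?mulr_gt0 // mul1r.
Qed.

Lemma critical3_kink : a1 = a0 -> a2 = 0 -> sphere_critical_point (@section_volume R 3) a.
Proof.
have [s_a2 s_a21 s_a10 s_a0] : [/\ 0 <= a2, a2 <= a1, a1 <= a0 & 0 < a0] by [].
move=> a1E a2E; right; have aa := unit_sphereE a_unit.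
have h2 : 2 * a0 ^+ 2 = 1 by move: a_sq; rewrite a1E a2E; lra.
(* Moving the vanishing coordinate off 0 enters the hexagon regime on both sides, and reflection in
   that coordinate gives evenness. *)
pose v := vec3 0 0 1 : 'rV[R]_3.
have vv : dot v v = 1 by rewrite dot3E !vec3E; ring.
have va : dot v a = 0 by rewrite dot3E !vec3E -/a2 a2E; ring.
have K0 : 0 < kappa / a0 ^+ 2 by rewrite divr_gt0 // exprn_gt0.
have fa : section_volume a = 4 * kappa / a0.
  rewrite section_volume3_parallelogram // -/a1 -/a2 a2E a1E normr0 addr0 gtr0_norm //.
have cE t : ((sphere_curve a v t 0 (inord 0) = (1 - t ^+ 2) * a0 / (1 + t ^+ 2)) *
            (sphere_curve a v t 0 (inord 1) = (1 - t ^+ 2) * a0 / (1 + t ^+ 2))) *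
            (sphere_curve a v t 0 (inord 2) = 2 * t / (1 + t ^+ 2)).
  by rewrite !mxE !inordK //= -/a0 -/a1 -/a2 a1E a2E; do ! split; ring.
have a0_le1 : a0 <= 1 by rewrite -(@ler_pXn2r _ 2) ?nnegrE ?(ltW a0_gt0) // expr1n; lra.
have a0_half : 1 / 2 <= a0.
  rewrite leNgt; apply/negP => lt; have : a0 ^+ 2 <= a0 * (1 / 2).
    by rewrite expr2 ler_wpM2l // ltW.
  lra.
(* The one-sided slope at 0 is [- 2 * kappa / a0 ^+ 2]; half of it is claimed. *)
apply: (@kink_not_differentiable _ _ a v aa vv va _ (kappa / a0 ^+ 2) (1 / 8)) => // t t0 t8.
have tt : t ^+ 2 <= t / 8 by rewrite expr2 mulrC ler_wpM2l ?(ltW t0) //; lra.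
have t2 : 0 < t ^+ 2 by rewrite exprn_gt0.
have D0 : 0 < 1 + t ^+ 2 by lra.
have S0 : 0 < 1 - t ^+ 2 by lra.
split.
  have -> : sphere_curve a v (- t) =
      signed_perm 1%g (fun i => i == inord 2) (sphere_curve a v t).
    have n02 : ((inord 0 : 'I_3) == inord 2) = false by rewrite -val_eqE /= !inordK.
    have n12 : ((inord 1 : 'I_3) == inord 2) = false by rewrite -val_eqE /= !inordK.
    apply/rowP; apply: ord3P; rewrite [RHS]mxE perm1 ?n02 ?n12 ?eqxx ?expr0 ?expr1 ?mul1r
      !cE sqrrN //; ring.
  by rewrite section_volume_signed_perm.
rewrite fa; set S := 1 - t ^+ 2 in S0 cE *; set D := 1 + t ^+ 2 in D0 cE *.
have [a0_neq0 S_neq0 D_neq0 t_neq0] : [/\ a0 != 0, S != 0, D != 0 & t != 0].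
  by rewrite !gt_eqF.
pose X := S * a0 / D; pose Y := 2 * t / D.
have X0 : 0 < X by rewrite divr_gt0 // mulr_gt0.
have Y0 : 0 < Y by rewrite divr_gt0 // mulr_gt0.
have cX : (sphere_curve a v t 0 (inord 0) = X) * (sphere_curve a v t 0 (inord 1) = X) *
  (sphere_curve a v t 0 (inord 2) = Y) by do ! split; rewrite cE.
have half_le : 1 / 2 * S <= a0 * S by rewrite ler_wpM2r // ltW.
have YX : Y <= X + X.
  rewrite /X /Y -mulrDl ler_pM2r ?invr_gt0 //; move: half_le; rewrite /S; lra.
have Sx := sphere_curve_unit aa vv va t.
rewrite section_volume3_hexagon ?cX //; try lra.
rewrite -/kappa (_ : _ / (X * X * Y) = kappa / a0 ^+ 2 * (D * (4 * S * a0 - 2 * t) / S ^+ 2));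
  last by rewrite /X /Y; field; rewrite a0_neq0 S_neq0 D_neq0 t_neq0.
rewrite (_ : 4 * kappa / a0 - kappa / a0 ^+ 2 * t = kappa / a0 ^+ 2 * (4 * a0 - t));
  last by field.
apply: ler_wpM2l; first exact: ltW.
rewrite ler_pdivrMr ?exprn_gt0 // -subr_ge0.
rewrite (_ : _ - _ = (2 * t * D - t * S ^+ 2) - 8 * (a0 * S) * t ^+ 2);
  last by rewrite /D /S; ring.
have S1 : S <= 1 by rewrite /S; lra.
have aS : a0 * S <= 1 by rewrite mulr_ile1 // ltW.
have S2 : S ^+ 2 <= 1 by rewrite expr_le1 // ltW.
have h1 : t * S ^+ 2 <= t * 1 by rewrite ler_wpM2l // ltW.
have h3 : t * 1 <= t * D by rewrite ler_wpM2l // ?(ltW t0) // /D; lra.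
have h4 : a0 * S * t ^+ 2 <= 1 * t ^+ 2 by rewrite ler_wpM2r // ltW.
lra.
Qed.

(** The equations are the Lagrange conditions of the hexagon volume, cleared of denominators and
    made homogeneous by inserting the sum of squares, which is 1 on the sphere. *)
Lemma equal_of_pairwise_critical (b0 b1 b2 : R) :
  0 < b2 -> b2 <= b1 -> b1 <= b0 ->
  (b0 - b1) * (2 * b2 * (b0 ^+ 2 + b0 * b1 + b1 ^+ 2) -
               (b0 + b1) * (b0 ^+ 2 + b1 ^+ 2 + b2 ^+ 2)) = 0 ->
  (b0 - b2) * (2 * b1 * (b0 ^+ 2 + b0 * b2 + b2 ^+ 2) -
               (b0 + b2) * (b0 ^+ 2 + b1 ^+ 2 + b2 ^+ 2)) = 0 ->
  (b1 - b2) * (2 * b0 * (b1 ^+ 2 + b1 * b2 + b2 ^+ 2) -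
               (b1 + b2) * (b0 ^+ 2 + b1 ^+ 2 + b2 ^+ 2)) = 0 ->
  b0 = b1 /\ b1 = b2.
Proof.
move=> p2 le21 le10.
have p1 : 0 < b1 by lra.
have p0 : 0 < b0 by lra.
have two (x y : R) : 0 < y -> 2 * x * (y ^+ 2 + y * x + x ^+ 2) -
    (y + x) * (y ^+ 2 + x ^+ 2 + x ^+ 2) = 0 -> y = x.
  (* When two of the numbers agree, the bracket of a remaining equation collapses to this
     product. *)
  move=> y0 h; have : y ^+ 2 * (x - y) = 0 by rewrite -h; ring.
  by move/eqP; rewrite mulf_eq0 expf_eq0 /= gt_eqF //= subr_eq0 => /eqP.
have [->|n01] := eqVneq b0 b1.
  have [->//|n12] := eqVneq b1 b2.
  move=> _ _ /eqP; rewrite mulf_eq0 subr_eq0 (negbTE n12) /= => /eqP h.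
  suff b21 : b2 = b1 by rewrite b21 eqxx in n12.
  by apply: two => //; rewrite -h; ring.
move=> /eqP; rewrite mulf_eq0 subr_eq0 (negbTE n01) /= => /eqP h01.
have [b12|n12] := eqVneq b1 b2.
  suff b01 : b0 = b1 by rewrite b01 eqxx in n01.
  by apply: two => //; rewrite -h01 -b12; ring.
have n02 : b0 != b2.
  by apply: contra_neq n12 => b02; apply/eqP; rewrite eq_le le21 andbT -b02.
move=> /eqP; rewrite mulf_eq0 subr_eq0 (negbTE n02) /= => /eqP h02 _.
(* For distinct numbers, the difference of the first two brackets has the factor [b1 - b2]; the
   other factor is negative because [b0] is the largest. *)
have : (b1 - b2) * (2 * (b1 * b2 - b0 ^+ 2) - (b0 ^+ 2 + b1 ^+ 2 + b2 ^+ 2)) = 0.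
  by transitivity (0 - 0 : R); [rewrite -{1}h01 -h02; ring|rewrite subrr].
move/eqP; rewrite mulf_eq0 subr_eq0 (negbTE n12) /= => /eqP h.
have : b1 * b2 <= b0 * b0 by rewrite ler_pM ?(ltW p1) ?(ltW p2) // (le_trans le21).
have : 0 < b0 ^+ 2 by rewrite exprn_gt0.
have := sqr_ge0 b1; have := sqr_ge0 b2; rewrite -expr2; lra.
Qed.

Lemma critical3_hexagon : a0 < a1 + a2 ->
  sphere_critical_point (@section_volume R 3) a <-> a0 = a1 /\ a1 = a2.
Proof.
have [s_a2 s_a21 s_a10 s_a0] : [/\ 0 <= a2, a2 <= a1, a1 <= a0 & 0 < a0] by [].
move=> lt012; have a2_gt0 : 0 < a2 by lra.
have a1_gt0 : 0 < a1 by lra.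
have H0 := second_order_inv_coord (a0_gt0 : 0 < a 0 (inord 0)).
have H1 := second_order_inv_coord (a1_gt0 : 0 < a 0 (inord 1)).
have H2 := second_order_inv_coord (a2_gt0 : 0 < a 0 (inord 2)).
have HS := second_orderD (second_orderD H0 H1) H2.
have HP := second_orderM (second_orderM H0 H1) H2.
have HG := second_orderZ kappa
  (second_orderD (second_orderZ 2 HS) (second_orderZ (-1) HP)).
(* Within [m / 4] the three coordinates move by less than [m] in total, so positivity and all
   triangle inequalities persist. *)
pose m := Num.min a2 (a1 + a2 - a0).
have m0 : 0 < m by rewrite lt_min a2_gt0 subr_gt0.
have [m2 mt] : m <= a2 /\ m <= a1 + a2 - a0 by rewrite !ge_min !lexx orbT.
have m4 : 0 < m / 4 by lra.
have volE x : unit_sphere R 3 x -> enorm (x - a) < m / 4 -> section_volume x =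
    kappa * (2 * ((x 0 (inord 0))^-1 + (x 0 (inord 1))^-1 + (x 0 (inord 2))^-1) +
             -1 * ((x 0 (inord 0))^-1 * (x 0 (inord 1))^-1 * (x 0 (inord 2))^-1)).
  move=> Sx; have x_sq : x 0 (inord 0) ^+ 2 + x 0 (inord 1) ^+ 2 + x 0 (inord 2) ^+ 2 = 1.
    by rewrite -(unit_sphereE Sx) dot3E !expr2.
  have := coord_dist x a (inord 0); have := coord_dist x a (inord 1).
  have := coord_dist x a (inord 2).
  rewrite -/a0 -/a1 -/a2; set e := enorm _.
  move=> /ler_normlP[h1 h2] /ler_normlP[h3 h4] /ler_normlP[h5 h6] em.
  have [x0p x1p x2p] : [/\ 0 < x 0 (inord 0), 0 < x 0 (inord 1) & 0 < x 0 (inord 2)].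
    by split; lra.
  rewrite section_volume3_hexagon //; try lra.
  rewrite -/kappa; move: x_sq x0p x1p x2p.
  set x0 := x 0 (inord 0); set x1 := x 0 (inord 1); set x2 := x 0 (inord 2).
  move=> x_sq x0p x1p x2p.
  transitivity (kappa * (2 * (x1 * x2 + x0 * x2 + x0 * x1) -
    (x0 ^+ 2 + x1 ^+ 2 + x2 ^+ 2)) / (x0 * x1 * x2)).
    by rewrite -!mulrA; congr (_ * _); rewrite !mulrA; congr (_ / _); ring.
  by rewrite x_sq; field; rewrite !gt_eqF.
have aV := volE a a_unit; rewrite subrr enorm0 in aV; have {}aV := aV m4.
have near x : unit_sphere R 3 x -> enorm (x - a) < m / 4 ->
    `|section_volume x - kappa *
     (2 * ((x 0 (inord 0))^-1 + (x 0 (inord 1))^-1 + (x 0 (inord 2))^-1) +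
      -1 * ((x 0 (inord 0))^-1 * (x 0 (inord 1))^-1 * (x 0 (inord 2))^-1))| <=
    0 * enorm (x - a) ^+ 2.
  by move=> Sx xm; rewrite volE // subrr normr0 mul0r.
have HV := second_order_near (lexx 0) m4 HG aV near.
apply: iff_trans (second_order_critical (unit_sphereE a_unit) HV) _.
set w := kappa *: _.
have [an0 an1 an2] : [/\ a0 != 0, a1 != 0 & a2 != 0] by rewrite !gt_eqF.
have wE v : dot w v = kappa * (
    (- 2 * a0^-1 ^+ 2 + a0^-1 ^+ 2 * (a1^-1 * a2^-1)) * v 0 (inord 0) +
    (- 2 * a1^-1 ^+ 2 + a1^-1 ^+ 2 * (a0^-1 * a2^-1)) * v 0 (inord 1) +
    (- 2 * a2^-1 ^+ 2 + a2^-1 ^+ 2 * (a0^-1 * a1^-1)) * v 0 (inord 2)).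
  by rewrite /w !(dotZl, dotDl) !dot_delta -/a0 -/a1 -/a2; field; rewrite an0 an1 an2.
have kn0 : kappa != 0 by rewrite gt_eqF.
split=> [Hv|[a01 a12] v va]; last first.
  have v_sum : v 0 (inord 0) + v 0 (inord 1) + v 0 (inord 2) = 0.
    by apply: (mulIf an0); rewrite mul0r -va dot3E -/a0 -/a1 -/a2 -a12 -a01; ring.
  rewrite wE -a12 -a01.
  transitivity (kappa * (- 2 * a0^-1 ^+ 2 + a0^-1 ^+ 2 * (a0^-1 * a0^-1)) *
    (v 0 (inord 0) + v 0 (inord 1) + v 0 (inord 2))); first by ring.
  by rewrite v_sum mulr0.
apply: (equal_of_pairwise_critical a2_gt0 a21 a10); rewrite a_sq mulr1.
(* Tangent vectors supported on two coordinates isolate one pair each; the monomial multiplied in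
   below clears the denominators. *)
- have : dot w (vec3 a1 (- a0) 0) = 0.
    by apply: Hv; rewrite dot3E !vec3E -/a0 -/a1 -/a2; ring.
  rewrite wE !vec3E => /(congr1 (fun z => z / kappa * (a0 ^+ 2 * a1 ^+ 2 * a2))).
  by rewrite !mul0r => <-; field; rewrite kn0 an0 an1 an2.
- have : dot w (vec3 a2 0 (- a0)) = 0.
    by apply: Hv; rewrite dot3E !vec3E -/a0 -/a1 -/a2; ring.
  rewrite wE !vec3E => /(congr1 (fun z => z / kappa * (a0 ^+ 2 * a2 ^+ 2 * a1))).
  by rewrite !mul0r => <-; field; rewrite kn0 an0 an1 an2.
- have : dot w (vec3 0 a2 (- a1)) = 0.
    by apply: Hv; rewrite dot3E !vec3E -/a0 -/a1 -/a2; ring.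
  rewrite wE !vec3E => /(congr1 (fun z => z / kappa * (a1 ^+ 2 * a2 ^+ 2 * a0))).
  by rewrite !mul0r => <-; field; rewrite kn0 an0 an1 an2.
Qed.

End Dim3.
End Cases.

(** * Critical sorted directions are the diagonal vectors *)

Section SortedDirections.
Context {R : realType}.

Lemma eq_inv_sqrt_nat (k : nat) (h : R) : k%:R * h ^+ 2 = 1 -> 0 <= h ->
  h = (Num.sqrt k%:R)^-1.
Proof.
move=> kh h0; have k0 : 0 < k%:R :> R.
  by rewrite lt_neqAle ler0n andbT; apply: contra_eq_neq kh => <-; rewrite mul0r eq_sym oner_eq0.
have -> : k%:R = h^-1 ^+ 2 :> R.
  by apply: divr1_eq; rewrite exprVn invrK.
by rewrite sqrtr_sqr ger0_norm ?invr_ge0 // invrK.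
Qed.

Lemma diagonal_vector1 n : diagonal_vector R n.+1 1 = delta_mx 0 (inord 0).
Proof.
apply/rowP => i; rewrite !mxE eqxx /= sqrtr1 invr1 ltnS leqn0.
by rewrite -val_eqE /= inordK //; case: eqP.
Qed.

Lemma diagonal_vector_ge0 n k i : 0 <= diagonal_vector R n k 0 i.
Proof. by rewrite mxE; case: ifP => // _; rewrite invr_ge0 sqrtr_ge0. Qed.

Lemma diagonal_vector_sorted n k (i j : 'I_n) : (i <= j)%N ->
  diagonal_vector R n k 0 j <= diagonal_vector R n k 0 i.
Proof.
move=> ij; rewrite !mxE; case: ifP => jk; first by rewrite (leq_ltn_trans ij jk).
by case: ifP => // _; rewrite invr_ge0 sqrtr_ge0.
Qed.

Lemma critical_sorted2 (a : 'rV[R]_2) : unit_sphere R 2 a ->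
  (forall i, 0 <= a 0 i) -> (forall i j : 'I_2, (i <= j)%N -> a 0 j <= a 0 i) ->
  sphere_critical_point (@section_volume R 2) a <->
  exists2 k, (1 <= k <= 2)%N & a = diagonal_vector R 2 k.
Proof.
move=> ua a_ge0 a_sorted; have a1 := a_ge0 (inord 1).
have a10 : a 0 (inord 1) <= a 0 (inord 0) by apply: a_sorted; rewrite !inordK.
have [lt10|eq10] := ltP (a 0 (inord 1)) (a 0 (inord 0)).
  apply: (iff_trans (critical2_dominant ua a1 a10 lt10)).
  rewrite -(diagonal_vector1 1); split; first by exists 1%N.
  case=> -[|[|[|k]]] // _ aE.
  by move: lt10; rewrite aE !mxE !inordK // ltxx.
have aE : a 0 (inord 1) = a 0 (inord 0) by apply/eqP; rewrite eq_le a10.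
split=> [_|_]; last exact: critical2_diagonal.
exists 2%N => //; have /eq_inv_sqrt_nat /(_ (a_ge0 _)) h : 2%:R * a 0 (inord 0) ^+ 2 = 1.
  by have := unit_sphereE ua; rewrite dot2E aE; lra.
by apply/rowP; apply: ord2P; rewrite [RHS]mxE inordK //= aE.
Qed.

Lemma critical_sorted3 (a : 'rV[R]_3) : unit_sphere R 3 a ->
  (forall i, 0 <= a 0 i) -> (forall i j : 'I_3, (i <= j)%N -> a 0 j <= a 0 i) ->
  sphere_critical_point (@section_volume R 3) a <->
  exists2 k, (1 <= k <= 3)%N & a = diagonal_vector R 3 k.
Proof.
move=> ua a_ge0 a_sorted; have a2 := a_ge0 (inord 2).
have a10 : a 0 (inord 1) <= a 0 (inord 0) by apply: a_sorted; rewrite !inordK.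
have a21 : a 0 (inord 2) <= a 0 (inord 1) by apply: a_sorted; rewrite !inordK.
have a_sq := unit_sphereE ua; rewrite dot3E in a_sq.
have s2 : 0 < (Num.sqrt 2%:R)^-1 :> R by rewrite invr_gt0 sqrtr_gt0.
have s3 : 0 < (Num.sqrt 3%:R)^-1 :> R by rewrite invr_gt0 sqrtr_gt0.
(* Shared by the parallelogram regime and its boundary: the diagonal vectors with [k] equal to 2 or
   3 have equal first two coordinates. *)
have dominant : (sphere_critical_point (@section_volume R 3) a <-> a = delta_mx 0 (inord 0)) ->
    a 0 (inord 1) != a 0 (inord 0) ->
    sphere_critical_point (@section_volume R 3) a <->
    exists2 k, (1 <= k <= 3)%N & a = diagonal_vector R 3 k.
  move=> crit neq10; apply: (iff_trans crit).
  rewrite -(diagonal_vector1 2); split; first by exists 1%N.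
  case=> -[|[|[|[|k]]]] // _ aE; by rewrite aE !mxE !inordK // eqxx in neq10.
have [lt120|gt120|eq120] := ltgtP (a 0 (inord 1) + a 0 (inord 2)) (a 0 (inord 0)).
- apply: dominant; first exact: critical3_dominant.
  by rewrite lt_eqF //; lra.
- apply: (iff_trans (critical3_hexagon ua a2 a21 a10 gt120)); split.
    move=> [a01 a12]; exists 3%N => //.
    have /eq_inv_sqrt_nat /(_ (a_ge0 _)) h : 3%:R * a 0 (inord 0) ^+ 2 = 1.
      by move: a_sq; rewrite -a12 -a01; lra.
    apply/rowP; apply: ord3P; rewrite [RHS]mxE inordK //=.
      by rewrite -a01.
    by rewrite -a12 -a01.
  (* For [k] equal to 1 or 2 the last two coordinates sum to at most the first, against [gt120]. *)
  move: gt120 => /[swap] -[[|[|[|[|k]]]] // _ ->]; rewrite !mxE !inordK //= ?addr0 ?ltxx //.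
  by rewrite sqrtr1 invr1 ltr10.
- have [a2E|n2] := eqVneq (a 0 (inord 2)) 0.
    have a1E : a 0 (inord 1) = a 0 (inord 0) by rewrite -eq120 a2E addr0.
    split=> [_|_]; last exact: critical3_kink.
    exists 2%N => //; have /eq_inv_sqrt_nat /(_ (a_ge0 _)) h : 2%:R * a 0 (inord 0) ^+ 2 = 1.
      by move: a_sq; rewrite a1E a2E; lra.
    apply/rowP; apply: ord3P; rewrite [RHS]mxE inordK //=.
    by rewrite a1E.
  have a2_gt0 : 0 < a 0 (inord 2) by rewrite lt_neqAle eq_sym n2.
  apply: dominant; first exact: critical3_transition.
  by rewrite lt_eqF //; lra.
Qed.

End SortedDirections.

Theorem theorem2 (R : realType) (n : nat) (hn : n = 2%N \/ n = 3%N)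
    (a : 'rV[R]_n) (ha : unit_sphere R n a) :
  critical_direction a <-> diagonal_direction a.
Proof.
have sorted_case (b : 'rV[R]_n) : unit_sphere R n b -> (forall i, 0 <= b 0 i) ->
    (forall i j : 'I_n, (i <= j)%N -> b 0 j <= b 0 i) ->
    sphere_critical_point (@section_volume R n) b <->
    exists2 k, (1 <= k <= n)%N & b = diagonal_vector R n k.
  by case: hn => nE; subst n; [exact: critical_sorted2|exact: critical_sorted3].
split=> [[_ crit]|[k k_n [s [e aE]]]].
  have [s [e [b_ge0 b_sorted]]] := exists_sorting_signed_perm a.
  have ub : unit_sphere R n (signed_perm s e a) by exact/unit_sphere_signed_perm.
  have [k k_n bE] := (sorted_case _ ub b_ge0 b_sorted).1 (critical_signed_perm s e crit).
  exists k => //; exists s^-1%g, (e \o (s^-1)%g).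
  by rewrite -[LHS](signed_permK s e) bE.
have {}aE : a = signed_perm s e (diagonal_vector R n k) by [].
(* The vector [diagonal_vector R n k] is already nonnegative and sorted, so its criticality is known
   and the symmetry carries it to [a]. *)
split=> //; rewrite aE; apply: critical_signed_perm; apply/sorted_case.
- by apply/(unit_sphere_signed_perm s e); rewrite -aE.
- exact: diagonal_vector_ge0.
- exact: diagonal_vector_sorted.
- by exists k.
Qed.
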